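(* As formal series in $y$ and $z^{\pm1}$, $$\exp\Big(\sum_{2g-2+n>0}\frac1{n!}\chi(\mathcal M_{g,n})\,y^nz^{2-2g}\Big)=\frac1{\sqrt{2\pi}}\int\exp\Big(\frac12(x-yz)^2+\sum_{2g-2+n>0}\frac1{n!}\chi(\overline{\mathcal M}_{g,n})\,x^nz^{2-2g-n}\Big)dx,$$ where the sums are over $g,n\ge0$ and the right-hand side is a formal Gaussian integral with propagator $-1$.
   Context: Formal Gaussian integral with propagator $-1$: in the exponent, separate the quadratic term $\frac12x^2$, expand the exponential of all remaining terms in powers of $x$, and integrate term by term by the rule $\frac1{\sqrt{2\pi}}\int e^{x^2/2}x^{2k}dx:=(-1)^k(2k-1)!!$ and $\frac1{\sqrt{2\pi}}\int e^{x^2/2}x^{2k+1}dx:=0$ (so that, in the Feynman graph expansion, each internal edge has weight $-1$); each coefficient of $y^nz^a$ is a finite sum. $\chi(\mathcal M_{g,n})=(-1)^n\frac{(2g-1)B_{2g}}{(2g)!}(2g+n-3)!$ for $2g-2+n>0$ is the orbifold Euler characteristic of $\mathcal M_{g,n}$ (Harer–Zagier formula), and $\chi(\overline{\mathcal M}_{g,n})$ is that of the Deligne–Mumford moduli space; by Bini–Harer, $\chi(\overline{\mathcal M}_{g,n})=n!\sum_{\Gamma}\frac1{|\mathrm{Aut}(\Gamma)|}\prod_v\chi(\mathcal M_{g_v,\mathrm{val}_v})$, the sum being over isomorphism classes of connected stable graphs of genus $g$ with $n$ unlabelled external edges (vertices $v$ have genus $g_v$ and valence $\mathrm{val}_v$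 with $2g_v-2+\mathrm{val}_v>0$; the genus of $\Gamma$ is $h^1(\Gamma)+\sum_vg_v$; automorphisms act on vertices and half-edges and may permute external edges). *)

(* Defs.v *)
From HB Require Import structures.
From mathcomp Require Import all_boot all_order all_algebra.
From mathcomp Require Import generic_quotient.
From mathcomp Require Import boolp classical_sets functions cardinality fsbigop.

Set Implicit Arguments.
Unset Strict Implicit.
Unset Printing Implicit Defensive.

Import Order.TTheory GRing.Theory Num.Theory.

Local Open Scope quotient_scope.
Local Open Scope classical_set_scope.
Local Open Scope ring_scope.

(* Formal series with exponents in a commutative monoid M (a vector of        *)
(* exponents, those of invertible variables being integers): f m is the       *)
(* coefficient of the monomial m.  No support condition is imposed; the       *)
(* sums \sum_(_ \in _) below have finite support for all the series of        *)
(* interest.                                                                  *)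
Definition fseries (M : nmodType) := M -> rat.

Section FormalSeries.
Variable M : nmodType.
Implicit Types f g : fseries M.

Definition monomial (m : M) : fseries M := fun m' => (m' == m)%:R.

Definition fmul f g : fseries M := fun m =>
  \sum_(p \in [set p : M * M | p.1 + p.2 = m]) f p.1 * g p.2.

Definition fpow f (k : nat) : fseries M := iter k (fmul f) (monomial 0).

Definition fsum (I : choiceType) (A : set I) (F : I -> fseries M) : fseries M :=
  fun m => \sum_(i \in A) F i m.

Definition fexp f : fseries M :=
  fsum [set: nat] (fun k => (k`!%:R)^-1 \*o fpow f k).

End FormalSeries.

Notation yz_exponent := (nat * int)%type.
Notation xyz_exponent := (nat * nat * int)%type.

(* y^n z^a and x^k y^n z^a *)
Definition monYZ (n : nat) (a : int) : fseries yz_exponent :=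
  monomial ((n, a) : yz_exponent).
Definition monXYZ (k n : nat) (a : int) : fseries xyz_exponent :=
  monomial ((k, n, a) : xyz_exponent).

(* (2 pi)^(-1/2) \int e^(x^2/2) x^k dx, by the rule for propagator -1 *)
Definition gauss_moment (k : nat) : rat :=
  if odd k then 0 else (-1) ^+ k./2 * (\prod_(i < k./2) (2 * i + 1)%N)%:R.

(* (2 pi)^(-1/2) \int exp(E) dx, for E the sum of x^2/2 and of the terms that *)
(* get expanded                                                               *)
Definition gauss_integral (E : fseries xyz_exponent) : fseries yz_exponent :=
  fun m => \sum_(k \in [set: nat])
    gauss_moment k * fexp (E \- (2^-1 \*o monXYZ 2 0 0)) (k, m.1, m.2).

(* The list B_0, ..., B_(n-1), by \sum_(k <= n) 'C(n.+1, k) B_k = (n == 0).   *)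
Fixpoint bernoulli_seq (n : nat) : seq rat :=
  if n is n'.+1 then
    let s := bernoulli_seq n' in
    rcons s (((n' == 0)%N%:R - \sum_(k < n') 'C(n'.+1, k)%:R * s`_k) / n'.+1%:R)
  else [::].

Definition bernoulli (n : nat) : rat := (bernoulli_seq n.+1)`_n.

(* 2g - 2 + n > 0 *)
Definition stable_type (g n : nat) : bool := (2 < 2 * g + n)%N.

(* Orbifold Euler characteristic of M_{g,n}, given by the Harer-Zagier        *)
(* formula; meaningful for stable_type g n only (the subtraction then does    *)
(* not truncate).                                                             *)
Definition chiM (g n : nat) : rat :=
  (-1) ^+ n * ((2 * g)%:R - 1) * bernoulli (2 * g) / (2 * g)`!%:R
  * (2 * g + n - 3)`!%:R.

(* Finite graphs with loops, multiple edges and unlabelled external edges,    *)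
(* whose vertices carry a genus.  Up to isomorphism the vertices and the      *)
(* half-edges are ordinals.  The 2-cycles of flip are the internal edges and  *)
(* its fixed points are the external edges.                                   *)
Record graph := Graph {
  nvert : nat;
  nhalf : nat;
  vgenus : 'I_nvert -> nat;
  endpoint : 'I_nhalf -> 'I_nvert;
  flip : 'I_nhalf -> 'I_nhalf;
  flipK : involutive flip
}.

HB.instance Definition _ := gen_eqMixin graph.
HB.instance Definition _ := gen_choiceMixin graph.

Definition graph_map (G G' : graph) : finType :=
  ({ffun 'I_(nvert G) -> 'I_(nvert G')} * {ffun 'I_(nhalf G) -> 'I_(nhalf G')})%type.

Definition is_isom (G G' : graph) (phi : graph_map G G') : bool :=
  `[< [/\ bijective phi.1, bijective phi.2,
          forall v, vgenus (phi.1 v) = vgenus v,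
          forall h, endpoint (phi.2 h) = phi.1 (endpoint h)
        & forall h, flip (phi.2 h) = phi.2 (flip h)] >].

Definition isomorphic (G G' : graph) : bool := [exists phi : graph_map G G', is_isom phi].

Definition card_aut (G : graph) : nat := #|[pred phi : graph_map G G | is_isom phi]|.

Lemma isomorphic_refl : reflexive isomorphic.
Proof.
move=> G; apply/existsP; exists ([ffun v => v], [ffun h => h]); apply/asboolP.
split=> /=.
- by exists id => v; rewrite ?ffunE.
- by exists id => h; rewrite ?ffunE.
- by move=> v; rewrite ffunE.
- by move=> h; rewrite !ffunE.
- by move=> h; rewrite !ffunE.
Qed.

Lemma isomorphic_sym : symmetric isomorphic.
Proof.
suff sub G G' : isomorphic G G' -> isomorphic G' G by move=> G G'; apply/idP/idP; exact: sub.
case/existsP=> -[a b] /asboolP[/= [a' aK a'K] [b' bK b'K] Hg He Hf].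
apply/existsP; exists ([ffun v => a' v], [ffun h => b' h]); apply/asboolP.
split=> /=.
- by exists a => v; rewrite ffunE.
- by exists b => h; rewrite ffunE.
- by move=> v; rewrite ffunE -Hg a'K.
- by move=> h; rewrite !ffunE -{2}(b'K h) He aK.
- by move=> h; rewrite !ffunE -{2}(b'K h) Hf bK.
Qed.

Lemma isomorphic_trans : transitive isomorphic.
Proof.
move=> G2 G1 G3 /existsP[[a b] /asboolP[/= Ba Bb Hg He Hf]].
case/existsP=> -[c d] /asboolP[/= Bc Bd Hg' He' Hf'].
apply/existsP; exists ([ffun v => c (a v)], [ffun h => d (b h)]); apply/asboolP.
split=> /=.
- by apply: (eq_bij (bij_comp Bc Ba)) => v; rewrite ffunE.
- by apply: (eq_bij (bij_comp Bd Bb)) => h; rewrite ffunE.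
- by move=> v; rewrite ffunE Hg' Hg.
- by move=> h; rewrite !ffunE He' He.
- by move=> h; rewrite !ffunE Hf' Hf.
Qed.

Canonical isomorphic_equiv :=
  EquivRel isomorphic isomorphic_refl isomorphic_sym isomorphic_trans.

Definition graph_class : choiceType := {eq_quot isomorphic}.

Section GraphInvariants.
Variable G : graph.

(* Half-edges at v: a loop at v counts twice, an external edge once. *)
Definition valence (v : 'I_(nvert G)) : nat := #|[pred h : 'I_(nhalf G) | endpoint h == v]|.

Definition n_external : nat := #|[pred h : 'I_(nhalf G) | flip h == h]|.
Definition n_internal : nat := (#|[pred h : 'I_(nhalf G) | flip h != h]|)./2.

Definition adjacent : rel 'I_(nvert G) := fun u v =>
  [exists h : 'I_(nhalf G), (endpoint h == u) && (endpoint (flip h) == v)].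

Definition n_components : nat := n_comp adjacent predT.

(* The empty graph has no component, hence is not connected. *)
Definition connected_graph : bool := n_components == 1%N.

(* First Betti number; the subtraction never truncates. *)
Definition betti1 : nat := (n_internal + n_components - nvert G)%N.

Definition graph_genus : nat := (betti1 + \sum_(v < nvert G) vgenus v)%N.

Definition stable_graph : bool :=
  [forall v : 'I_(nvert G), stable_type (vgenus v) (valence v)].

Definition stable_graph_of_type (g n : nat) : bool :=
  [&& connected_graph, stable_graph, graph_genus == g & n_external == n].

Definition graph_weight : rat :=
  (card_aut G)%:R^-1 * \prod_(v < nvert G) chiM (vgenus v) (valence v).

End GraphInvariants.

(* Orbifold Euler characteristic of the Deligne-Mumford space, given by the   *)
(* Bini-Harer formula.                                                        *)
Definition chiMbar (g n : nat) : rat :=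
  n`!%:R * \sum_(c \in [set c : graph_class | stable_graph_of_type (repr c) g n])
    graph_weight (repr c).

Definition stable_types : set (nat * nat) := [set p | stable_type p.1 p.2].

(* Main.v *)
Require Import Defs.
From HB Require Import structures.
From mathcomp Require Import generic_quotient.
From mathcomp Require Import boolp classical_sets fsbigop.
From mathcomp Require Import all_boot all_order all_algebra.
From mathcomp Require Import zify ring.

(** The identity is a purely combinatorial inversion: the numbers chi(Mbar_{g,n})
are obtained from the chi(M_{g,n}) by a sum over stable graphs, that is, by a
Gaussian integral with propagator 1, and the integral with propagator -1 undoes
this.  Put t = 1/z, s = y z, and
- V(x) = sum of chi(M_{g,n}) / n! x^n t^(2g-2+n),
- W(x) = sum of chi(Mbar_{g,n}) / n! x^n t^(2g-2+n),
over stable (g,n), so that the left-hand side of the theorem is exp V(s).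

Expanding the graph sum.  Euler's relation gives
2g - 2 + n = sum over the vertices of (2g_v - 2 + val_v) for a connected graph,
so the power of t is multiplicative over vertices.  By orbit counting, summing
over isomorphism classes with weight 1/|Aut| is summing over graphs labelled by
p vertices and q half-edges with weight 1/(p! q!); hence W is the generating
series of connected labelled graphs (sum_graph_classes, coef_connected_series).

Exponential formula.  exp W is then the generating series A of all labelled
graphs.  Exponentials are characterised by the differential equation
Y' = P' Y in the variable t, Y(0) = 1 (pexp_unique).  A satisfies it
because d/dt of the product of the vertex weights splits as a sum over the
connected components of the graph, and a graph with a distinguished component
is a connected graph glued to an arbitrary one
(component_sum, deriv_graph_sum, graph_series_solves).

Wick's theorem.  In a graph on q half-edges the incidence map and the
involution pairing half-edges are independent choices.  The incidence maps
contribute q! times the coefficient of x^q in exp V (iterated Leibniz rule,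
derivn_prod) and the involutions contribute u_q(x), the sum of x^fix over
the involutions of q points.  So A = sum over q of u_q(x) [x^q] exp V
(coef_graph_series).

Inversion.  After removing x^2/2, the Gaussian part of the integrand is
exp(-x s + s^2/2) = sum of h_n(x) s^n, where the h_n are, up to constants,
the Hermite polynomials of imaginary argument.
Writing G for the formal integral, the rule for propagator -1 is integration by
parts G(x p) = - G(p').  Together with h_(n+1)' = - h_n and
u_(q+1) = x u_q + u_q', it gives G(h_n u_q) = 1 if n = q and 0 otherwise
(gauss_hermite_involution).  Hence the coefficient of s^n t^b in the integral of
exp(-x s + s^2/2) A is [x^n t^b] exp V, which is the claim.

All this takes place in polynomial rings, with a variable marking the order in
t (and in s, for the integrand) and exponentials truncated at an order N; the
predicate [represents] says that a formal series agrees with such a polynomial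
up to order N, and it is compatible with the operations on series
(representsM, represents_exp).  An order N depending on the coefficient under
study always suffices. *)

Set Implicit Arguments.
Unset Strict Implicit.
Unset Printing Implicit Defensive.

Import Order.TTheory GRing.Theory Num.Theory.

Local Open Scope ring_scope.

(** * Truncated exponentials and their differential equation *)

Section TruncatedExponential.
Variables (R : comNzRingType) (rho : {rmorphism rat -> R}).
Implicit Types P Y : {poly R}.

(** rho embeds the rational scalars in the coefficient ring, which need not be an
algebra over the rationals canonically. *)
Definition pexp N P : {poly R} :=
  \sum_(k < N.+1) rho (k`!%:R^-1) *: P ^+ k.

Definition solves_exp_ode N P Y : Prop :=
  Y`_0 = 1 /\ forall i, (i < N)%N -> (Y^`())`_i = (P^`() * Y)`_i.

(** P has no constant term, so each factor raises the order by one. *)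
Lemma coef_exp_low P k i : P`_0 = 0 -> (i < k)%N -> (P ^+ k)`_i = 0.
Proof.
move=> P0; elim: k i => // k IHk i ik; rewrite exprS coefM big1 // => j _.
case: (posnP j) => [-> | j0]; first by rewrite P0 mul0r.
by have ltj := ltn_ord j; rewrite IHk ?mulr0 //; lia.
Qed.

Lemma rho_factS k : rho (k.+1`!%:R^-1) *+ k.+1 = rho (k`!%:R^-1).
Proof.
rewrite -rmorphMn -mulr_natr factS natrM invfM -mulrA mulrC -mulrA mulfV ?mulr1 //.
by rewrite pnatr_eq0.
Qed.

Lemma pexp_solves_exp_ode N P : P`_0 = 0 -> solves_exp_ode N P (pexp N P).
Proof.
move=> P0; split.
  rewrite /pexp coef_sum big_ord_recl big1 => [|k _].
    by rewrite coefZ expr0 coef1 fact0 invr1 rmorph1 mul1r addr0.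
  by rewrite coefZ coef_exp_low // mulr0.
move=> i iN; rewrite /pexp linear_sum big_ord_recl /= expr0 derivZ.
rewrite -[X in X^`()]/(1%:P) derivC scaler0 add0r.
have -> : \sum_(k < N) (rho ((bump 0 k)`!%:R^-1) *: P ^+ bump 0 k)^`() =
    P^`() * \sum_(k < N) rho (k`!%:R^-1) *: P ^+ k.
  rewrite mulr_sumr; apply: eq_bigr => k _.
  rewrite /bump /= add1n derivZ deriv_exp /= -scalerMnr scalerMnl rho_factS.
  by rewrite scalerAr.
rewrite [in RHS]big_ord_recr /= mulrDr coefD -scalerAr coefZ.
rewrite [X in _ + _ * X]coefM [X in _ + _ * X]big1 ?mulr0 ?addr0 // => j _.
by have ltj := ltn_ord j; rewrite [X in _ * X]coef_exp_low ?mulr0 //; lia.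
Qed.

(** The equation determines the coefficients one after the other, since i + 1 is invertible. *)
Lemma exp_ode_unique N P Y Z : solves_exp_ode N P Y -> solves_exp_ode N P Z ->
  forall i, (i <= N)%N -> Y`_i = Z`_i.
Proof.
move=> [Y0 Yode] [Z0 Zode]; elim/ltn_ind => -[|i] IH iN; first by rewrite Y0.
have: Y`_i.+1 *+ i.+1 = Z`_i.+1 *+ i.+1.
  rewrite -!coef_deriv Yode // Zode // !coefM; apply: eq_bigr => j _.
  by have ltj := ltn_ord j; rewrite IH //; lia.
have unit_nat : rho (i.+1%:R^-1) * i.+1%:R = 1.
  by rewrite -(rmorph_nat rho) -rmorphM mulVf ?rmorph1 // pnatr_eq0.
by move=> eqYZ; rewrite -[LHS]mul1r -[RHS]mul1r -unit_nat -!mulrA !mulr_natl eqYZ.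
Qed.

(** Exponentials are recognised by their logarithmic derivative, which for
generating series of graphs is easier to compute than powers. *)
Lemma pexp_unique N P Y : P`_0 = 0 -> solves_exp_ode N P Y ->
  forall i, (i <= N)%N -> (pexp N P)`_i = Y`_i.
Proof. by move=> P0; apply: exp_ode_unique; apply: pexp_solves_exp_ode. Qed.

Lemma solves_exp_odeM N P Q Y Z : solves_exp_ode N P Y -> solves_exp_ode N Q Z ->
  solves_exp_ode N (P + Q) (Y * Z).
Proof.
move=> [Y0 Yode] [Z0 Zode]; split; first by rewrite coef0M Y0 Z0 mulr1.
move=> i iN; rewrite derivM derivD mulrDl !coefD; congr (_ + _).
  rewrite mulrA !coefM; apply: eq_bigr => j _; rewrite Yode //.
  by have ltj := ltn_ord j; lia.
rewrite mulrCA !coefM; apply: eq_bigr => j _; rewrite Zode //.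
by have ltj := ltn_ord j; lia.
Qed.
End TruncatedExponential.

(** * Labelled graphs, components and gluing *)

Lemma card_sum_nat (T : finType) (P : pred T) : #|P| = (\sum_x P x)%N.
Proof. by rewrite -sum1_card big_mkcond. Qed.

Section Components.
Variables V H : finType.
Implicit Types (e : {ffun H -> V}) (s : {ffun H -> H}) (X Y : {set V}).

Definition is_involution s := [forall h, s (s h) == h].
Definition nfix s := #|[pred h | s h == h]|.
Definition degree e v := #|[pred h | e h == v]|.

Definition edge_closed e s X := [forall h, (e h \in X) ==> (e (s h) \in X)].

(** A connected component is a minimal nonempty set of vertices that no edge
leaves; this form needs no paths and restricts well to subgraphs. *)
Definition is_component e s X :=
  [&& X != set0, edge_closed e s X
    & [forall Y : {set V},
        [&& Y != set0, Y \subset X & edge_closed e s Y] ==> (Y == X)]].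

Definition is_connected e s := is_component e s setT.

Lemma edge_closedP e s X :
  reflect (forall h, e h \in X -> e (s h) \in X) (edge_closed e s X).
Proof. by apply: (iffP forallP) => cl h; [exact: (implyP (cl h)) | apply/implyP/cl]. Qed.

Lemma is_componentP e s X :
  reflect [/\ X != set0, edge_closed e s X
            & forall Y : {set V}, Y != set0 -> Y \subset X -> edge_closed e s Y -> Y = X]
          (is_component e s X).
Proof.
apply: (iffP and3P) => -[X0 clX minX]; split=> //.
  by move=> Y Y0 YX clY; apply/eqP/(implyP (forallP minX Y)); rewrite Y0 YX.
by apply/forallP=> Y; apply/implyP=> /and3P[Y0 YX clY]; apply/eqP/minX.
Qed.

Lemma edge_closedC e s X : is_involution s -> edge_closed e s X -> edge_closed e s (~: X).
Proof.
move=> /forallP sK /edge_closedP clX; apply/edge_closedP=> h; rewrite !inE.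
by apply: contra => /clX; rewrite (eqP (sK h)).
Qed.

(** The component of v is the intersection of the closed sets containing v: a
closed set missing v has a closed complement, so nothing smaller is closed. *)
Lemma mem_component_unique e s v : is_involution s ->
  exists2 X, is_component e s X & forall Y, is_component e s Y -> (v \in Y) = (Y == X).
Proof.
move=> sI; pose X := \bigcap_(Y : {set V} | (v \in Y) && edge_closed e s Y) Y.
have vX : v \in X by apply/bigcapP=> Y /andP[].
have clX : edge_closed e s X.
  apply/edge_closedP=> h /bigcapP ehX; apply/bigcapP=> Y vY.
  have /andP[_ /edge_closedP clY] := vY; exact/clY/ehX.
have minX Y : v \in Y -> edge_closed e s Y -> X \subset Y.
  by move=> vY clY; apply: bigcap_inf; rewrite vY.
have X0 : X != set0 by apply/set0Pn; exists v.
exists X.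
  apply/is_componentP; split=> // Y Y0 YX clY; apply/eqP; rewrite eqEsubset YX /=.
  case vY: (v \in Y); first exact: minX.
  have /minX : v \in ~: Y by rewrite inE vY.
  move=> /(_ (edge_closedC sI clY)) XY; case/set0Pn: Y0 => u uY.
  by have := subsetP XY u (subsetP YX u uY); rewrite inE uY.
move=> Y /is_componentP[Y0 clY minY]; apply/idP/eqP=> [vY | ->] //.
by apply/esym/minY => //; exact: minX.
Qed.

Lemma sum_over_components (M : nmodType) e s (F : V -> M) : is_involution s ->
  \sum_v F v = \sum_(X | is_component e s X) \sum_(v in X) F v.
Proof.
move=> sI; rewrite (exchange_big_dep xpredT) //=; apply: eq_bigr => v _.
have [X cX memX] := mem_component_unique e v sI.
rewrite (big_pred1 X) // => Y /=; apply/andP/eqP=> [[cY] | ->].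
  by rewrite memX // => /eqP.
by rewrite memX.
Qed.
End Components.

(** A graph on V and H in which no edge joins the images of V1 and V2 is the same
thing as a pair of graphs on (V1, H1) and (V2, H2).  The bijections f and g
only relabel; using them instead of subsets avoids restricting functions to
subtypes. *)
Section Glue.
Variables (V1 V2 V H1 H2 H : finType).
Variables (f : V1 + V2 -> V) (g : H1 + H2 -> H).
Variables (f' : V -> V1 + V2) (g' : H -> H1 + H2).
Hypotheses (fK : cancel f f') (f'K : cancel f' f) (gK : cancel g g') (g'K : cancel g' g).

Let S := [set f (inl v) | v : V1].
Let T := [set g (inl h) | h : H1].

Definition glue_ends (e1 : {ffun H1 -> V1}) (e2 : {ffun H2 -> V2}) : {ffun H -> V} :=
  [ffun h => match g' h with inl h1 => f (inl (e1 h1)) | inr h2 => f (inr (e2 h2)) end].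
Definition glue_flip (s1 : {ffun H1 -> H1}) (s2 : {ffun H2 -> H2}) : {ffun H -> H} :=
  [ffun h => match g' h with inl h1 => g (inl (s1 h1)) | inr h2 => g (inr (s2 h2)) end].

Let fI := can_inj fK.
Let gI := can_inj gK.

Let f_inS u : (f u \in S) = if u is inl _ then true else false.
Proof.
apply/imsetP/idP=> [[v _ /fI ->] // | ]; by case: u => // v _; exists v.
Qed.
Let g_inT u : (g u \in T) = if u is inl _ then true else false.
Proof.
apply/imsetP/idP=> [[v _ /gI ->] // | ]; by case: u => // v _; exists v.
Qed.

Variables (e1 : {ffun H1 -> V1}) (e2 : {ffun H2 -> V2}).
Variables (s1 : {ffun H1 -> H1}) (s2 : {ffun H2 -> H2}).
Let e := glue_ends e1 e2.
Let s := glue_flip s1 s2.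

Let eE1 h : e (g (inl h)) = f (inl (e1 h)). Proof. by rewrite ffunE gK. Qed.
Let eE2 h : e (g (inr h)) = f (inr (e2 h)). Proof. by rewrite ffunE gK. Qed.
Let sE1 h : s (g (inl h)) = g (inl (s1 h)). Proof. by rewrite ffunE gK. Qed.
Let sE2 h : s (g (inr h)) = g (inr (s2 h)). Proof. by rewrite ffunE gK. Qed.

Lemma glue_involution : is_involution s = is_involution s1 && is_involution s2.
Proof.
apply/forallP/andP=> [sK | [/forallP s1K /forallP s2K] h].
  split; apply/forallP=> h.
    by have := sK (g (inl h)); rewrite !sE1 => /eqP/gI[->].
  by have := sK (g (inr h)); rewrite !sE2 => /eqP/gI[->].
by rewrite -(g'K h); case: (g' h) => h'; rewrite ?sE1 ?sE2 (eqP (s1K _), eqP (s2K _)).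
Qed.

Lemma glue_nfix : nfix s = (nfix s1 + nfix s2)%N.
Proof.
rewrite /nfix !card_sum_nat (reindex g) /=; last by exists g' => h _.
rewrite big_sumType /=; congr (_ + _)%N; apply: eq_bigr => h _.
  by rewrite /= sE1 (inj_eq gI).
by rewrite /= sE2 (inj_eq gI).
Qed.

Lemma glue_degree1 v : degree e (f (inl v)) = degree e1 v.
Proof.
rewrite /degree !card_sum_nat (reindex g) /=; last by exists g' => h _.
rewrite big_sumType /= [X in (_ + X)%N]big1 ?addn0 => [|h _].
  by apply: eq_bigr => h _; rewrite /= eE1 (inj_eq fI).
by rewrite /= eE2 (inj_eq fI).
Qed.

Lemma glue_degree2 v : degree e (f (inr v)) = degree e2 v.
Proof.
rewrite /degree !card_sum_nat (reindex g) /=; last by exists g' => h _.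
rewrite big_sumType /= [X in (X + _)%N]big1 ?add0n => [|h _].
  by apply: eq_bigr => h _; rewrite /= eE2 (inj_eq fI).
by rewrite /= eE1 (inj_eq fI).
Qed.

Lemma glue_preimset : e @^-1: S = T.
Proof.
apply/setP=> h; rewrite -(g'K h) inE g_inT.
by case: (g' h) => h'; rewrite ?eE1 ?eE2 f_inS.
Qed.

Lemma glue_prodS (R : comNzRingType) (F : nat -> R) :
  \prod_(v in S) F (degree e v) = \prod_v F (degree e1 v).
Proof.
rewrite big_imset /= => [|v v' _ _ /fI[]] //.
by apply: eq_big => // v _; rewrite glue_degree1.
Qed.

Lemma glue_prodSC (R : comNzRingType) (F : nat -> R) :
  \prod_(v | v \notin S) F (degree e v) = \prod_v F (degree e2 v).
Proof.
rewrite (reindex f) /=; last by exists f' => h _.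
rewrite big_mkcond big_sumType /= big1 ?mul1r => [|v _]; last by rewrite f_inS.
by apply: eq_bigr => v _; rewrite f_inS /= glue_degree2.
Qed.

Let edge_closed_inl (X : {set V1}) :
  edge_closed e s [set f (inl v) | v in X] = edge_closed e1 s1 X.
Proof.
have memf v : (f (inl v) \in [set f (inl v) | v in X]) = (v \in X).
  by apply: (mem_imset (f := fun v => f (inl v))) => u u' /fI[].
apply/edge_closedP/edge_closedP=> clX h.
  by have := clX (g (inl h)); rewrite sE1 !eE1 !memf.
rewrite -(g'K h); case: (g' h) => h'; rewrite ?sE1 ?sE2 ?eE1 ?eE2 ?memf; first exact: clX.
by case/imsetP=> v _ /fI.
Qed.

Lemma glue_component : is_component e s S = is_connected e1 s1.
Proof.
have imI : injective (fun v => f (inl v)) by move=> u u' /fI[].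
have im0 (X : {set V1}) : ([set f (inl v) | v in X] != set0) = (X != set0).
  by rewrite -!card_gt0 card_imset.
have ST : S = [set f (inl v) | v in [set: V1]].
  by apply/setP=> v; apply/imsetP/imsetP=> -[u _ ->]; exists u.
rewrite ST; apply/is_componentP/is_componentP=> -[S0 clS minS]; split.
- by rewrite im0 in S0.
- by rewrite edge_closed_inl in clS.
- move=> Y Y0 _ clY.
  have eqI : [set f (inl v) | v in Y] = [set f (inl v) | v in [set: V1]].
    by apply: minS; rewrite ?im0 ?edge_closed_inl // imsetS // subsetT.
  exact: (imset_inj imI eqI).
- by rewrite im0.
- by rewrite edge_closed_inl.
move=> Y Y0 YS clY; pose X := [set v | f (inl v) \in Y].
have YX : Y = [set f (inl v) | v in X].
  apply/setP=> v; apply/idP/imsetP=> [vY | [u uX ->]]; last by rewrite inE in uX.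
  have /imsetP[u _ vu] := subsetP YS v vY; exists u => //.
  by rewrite inE -vu.
have XT : X = setT by apply: minS; rewrite ?subsetT // -?im0 -?edge_closed_inl -YX.
by rewrite YX XT.
Qed.
End Glue.

Section GraphSums.
Variables (R : comNzRingType) (x : R) (Phi : nat -> {poly R}).

Definition lgraph (V H : finType) : finType := ({ffun H -> V} * {ffun H -> H})%type.

(** Phi n is the weight of a vertex of valence n and x that of an external edge.
The genera of the vertices are summed inside Phi. *)
Definition graph_sum (V H : finType) : {poly R} :=
  \sum_(G : lgraph V H | is_involution G.2)
    (x ^+ nfix G.2)%:P * \prod_v Phi (degree G.1 v).

Definition connected_sum (V H : finType) : {poly R} :=
  \sum_(G : lgraph V H | is_involution G.2 && is_connected G.1 G.2)
    (x ^+ nfix G.2)%:P * \prod_v Phi (degree G.1 v).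

(** Graphs having S as a component, with T the half-edges attached to S: gluing
is injective, its image is exactly this set of graphs, and weights multiply.
The derivative falls on the part carried by S. *)
Lemma component_sum (V1 V2 V H1 H2 H : finType) (f : V1 + V2 -> V) (g : H1 + H2 -> H) :
  bijective f -> bijective g ->
  let S := [set f (inl v) | v : V1] in let T := [set g (inl h) | h : H1] in
  \sum_(G : lgraph V H | [&& is_involution G.2, is_component G.1 G.2 S & G.1 @^-1: S == T])
    (x ^+ nfix G.2)%:P * ((\prod_(v in S) Phi (degree G.1 v))^`()
                         * \prod_(v | v \notin S) Phi (degree G.1 v))
  = (connected_sum V1 H1)^`() * graph_sum V2 H2.
Proof.
move=> [f' fK f'K] [g' gK g'K] S T.
rewrite linear_sum /= mulr_suml.
under [RHS]eq_bigr do rewrite mulr_sumr.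
rewrite pair_big /=.
pose glue (GG : lgraph V1 H1 * lgraph V2 H2) : lgraph V H :=
  (glue_ends f g' GG.1.1 GG.2.1, glue_flip g g' GG.1.2 GG.2.2).
pose A := [pred GG : lgraph V1 H1 * lgraph V2 H2 |
  is_involution GG.1.2 && is_connected GG.1.1 GG.1.2 && is_involution GG.2.2].
have glue_inj : {in A &, injective glue}.
  move=> [[e1 s1] [e2 s2]] [[d1 r1] [d2 r2]] _ _ [] /ffunP ed /ffunP sr.
  have fI := can_inj fK; have gI := can_inj gK.
  congr (((_ , _) , (_ , _))); apply/ffunP=> h.
  + by have := ed (g (inl h)); rewrite !ffunE gK => /fI[].
  + by have := sr (g (inl h)); rewrite !ffunE gK => /gI[].
  + by have := ed (g (inr h)); rewrite !ffunE gK => /fI[].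
  + by have := sr (g (inr h)); rewrite !ffunE gK => /gI[].
transitivity (\sum_(G in glue @: A)
    (x ^+ nfix G.2)%:P * ((\prod_(v in S) Phi (degree G.1 v))^`()
                         * \prod_(v | v \notin S) Phi (degree G.1 v))).
  apply: eq_bigl => -[e s]; apply/idP/imsetP => /=; last first.
    case=> -[[e1 s1] [e2 s2]] /andP[/andP[/= i1 c1] i2] [-> ->].
    rewrite (glue_involution gK g'K) i1 i2 (glue_component fK gK g'K) c1.
    by rewrite (glue_preimset fK gK g'K) eqxx.
  case/and3P=> sI cS /eqP eT; have sK h := eqP (forallP sI h).
  have /is_componentP[_ /edge_closedP clS _] := cS.
  have eST h : (e h \in S) = (h \in T) by rewrite -eT inE.
  have sT h : (s h \in T) = (h \in T).
    by rewrite -!eST; apply/idP/idP=> /clS; rewrite ?sK.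
  have gT u : (g u \in T) = if u is inl _ then true else false.
    apply/imsetP/idP=> [[v _ /(can_inj gK) ->] // | ]; by case: u => // v _; exists v.
  have inr_S v : v \notin S -> exists u, v = f (inr u).
    rewrite -(f'K v); case: (f' v) => u; last by exists u.
    by rewrite imset_f.
  have inr_T h : h \notin T -> exists u, h = g (inr u).
    rewrite -(g'K h); case: (g' h) => u; last by exists u.
    by rewrite imset_f.
  (* The four restrictions of e and s exist because S is closed under flips. *)
  have /fin_all_exists[e1 e1P] h : exists v, e (g (inl h)) = f (inl v).
    have : e (g (inl h)) \in S by rewrite eST gT.
    by case/imsetP=> v _ ->; exists v.
  have /fin_all_exists[s1 s1P] h : exists h', s (g (inl h)) = g (inl h').
    have : s (g (inl h)) \in T by rewrite sT gT.
    by case/imsetP=> v _ ->; exists v.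
  have /fin_all_exists[e2 e2P] h : exists v, e (g (inr h)) = f (inr v).
    by apply: inr_S; rewrite eST gT.
  have /fin_all_exists[s2 s2P] h : exists h', s (g (inr h)) = g (inr h').
    by apply: inr_T; rewrite sT gT.
  have eqG : (e, s) = glue (([ffun h => e1 h], [ffun h => s1 h]),
                            ([ffun h => e2 h], [ffun h => s2 h])).
    congr pair; apply/ffunP=> h; rewrite -{1}(g'K h) ffunE /=;
      by case: (g' h) => u; rewrite ffunE ?e1P ?e2P ?s1P ?s2P.
  exists (([ffun h => e1 h], [ffun h => s1 h]), ([ffun h => e2 h], [ffun h => s2 h])) => //.
  rewrite inE /=; case: eqG => eE sE; move: sI cS.
  by rewrite eE sE (glue_involution gK g'K) (glue_component fK gK g'K) => /andP[-> ->] ->.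
rewrite big_imset //=; apply: eq_bigr => -[[e1 s1] [e2 s2]] _ /=.
rewrite (glue_nfix gK g'K) (glue_prodS fK gK g'K) (glue_prodSC fK f'K gK g'K).
by rewrite exprD polyCM !mul_polyC derivZ -!scalerAl -!scalerAr mul_polyC !scalerA.
Qed.
End GraphSums.

(** * Derivative of the sum over all graphs *)

Lemma deriv_prod (R : comNzRingType) (I : finType) (A : {set I}) (F : I -> {poly R}) :
  (\prod_(i in A) F i)^`() =
  \sum_(i in A) (F i)^`() * \prod_(j in A | j != i) F j.
Proof.
move: {2}#|A| (leqnn #|A|) => n; elim: n A => [|n IHn] A.
  by rewrite leqn0 cards_eq0 => /eqP->; rewrite !big_set0 -[1]/(1%:P) derivC.
case: (set_0Vmem A) => [-> _ | [i iA]]; first by rewrite !big_set0 -[1]/(1%:P) derivC.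
rewrite (cardsD1 i A) iA add1n ltnS => cA.
have: i \notin A :\ i by rewrite !inE eqxx.
move: (A :\ i) (setD1K iA) cA => B <- cB {iA A} iA; have IH := IHn B cB.
move: B iA IH {cB} => A iA IH.
rewrite big_setU1 //= derivM IH [RHS]big_setU1 //=; congr (_ * _ + _).
  apply: eq_bigl => j; rewrite !inE; case: eqVneq => [-> | ] /=; last by rewrite andbT.
  exact/negbTE.
rewrite mulr_sumr; apply: eq_bigr => j jA; rewrite mulrCA; congr (_ * _).
rewrite [RHS](bigD1 i) /=; last first.
  by rewrite !inE eqxx /=; apply: contraNneq iA => ->.
congr (_ * _); apply: eq_bigl => k; rewrite !inE.
by case: (eqVneq k i) => [-> | ] /=; rewrite ?andbF ?andbT ?(negbTE iA).
Qed.

Section ExponentialFormula.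
Variables (R : comNzRingType) (x : R) (Phi : nat -> {poly R}).
Local Notation graph_sum := (graph_sum x Phi).
Local Notation connected_sum := (connected_sum x Phi).

(** By the Leibniz rule the derivative distributes over the vertices, which are
then grouped according to their component. *)
Lemma deriv_prod_components (V H : finType) (e : {ffun H -> V}) (s : {ffun H -> H})
    (F : V -> {poly R}) : is_involution s ->
  (\prod_v F v)^`() =
  \sum_(S | is_component e s S) (\prod_(v in S) F v)^`() * \prod_(v | v \notin S) F v.
Proof.
move=> sI.
have -> : \prod_v F v = \prod_(v in [set: V]) F v by apply: eq_bigl => v; rewrite inE.
rewrite deriv_prod (eq_bigl xpredT) => [|v]; last by rewrite inE.
rewrite (sum_over_components e _ sI); apply: eq_bigr => S _.
rewrite deriv_prod mulr_suml; apply: eq_bigr => v vS; rewrite -mulrA; congr (_ * _).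
rewrite (bigID (mem S)) /=; congr (_ * _); apply: eq_bigl => u; rewrite inE /=.
  exact: andbC.
by case: eqVneq => [-> | ]; rewrite ?vS.
Qed.

Lemma split_bij (T : finType) (A : {set T}) :
  exists2 f : 'I_#|A| + 'I_#|~: A| -> T, bijective f & [set f (inl i) | i : 'I_#|A|] = A.
Proof.
exists (fun u => match u with inl i => enum_val i | inr i => enum_val i end).
  apply: inj_card_bij; last by rewrite card_sum !card_ord cardsC.
  move=> [i|i] [j|j] /=; try by move/enum_val_inj=> ->.
    by move=> ij; have := enum_valP j; rewrite -ij inE (enum_valP i).
  by move=> ij; have := enum_valP i; rewrite ij inE (enum_valP j).
apply/setP=> y; apply/imsetP/idP=> [[i _ ->] | yA]; first exact: enum_valP.
by exists (enum_rank_in yA y) => //; rewrite enum_rankK_in.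
Qed.

(** Distinguish the component S hit by the derivative and the set T of its
half-edges. *)
Lemma deriv_graph_sum_sets (V H : finType) :
  (graph_sum V H)^`() =
  \sum_(S : {set V}) \sum_(T : {set H})
    (connected_sum 'I_#|S| 'I_#|T|)^`() * graph_sum 'I_#|~: S| 'I_#|~: T|.
Proof.
rewrite /graph_sum linear_sum /=.
under eq_bigr => G sI.
  rewrite mul_polyC derivZ -mul_polyC (deriv_prod_components G.1 _ sI) mulr_sumr; over.
rewrite (exchange_big_dep xpredT) //=; apply: eq_bigr => S _.
rewrite (partition_big (fun G : lgraph V H => G.1 @^-1: S) xpredT) //=; apply: eq_bigr => T _.
have [f f_bij fS] := split_bij S; have [g g_bij gT] := split_bij T.
rewrite -(component_sum x Phi f_bij g_bij) fS gT.
by apply: eq_bigl => G; rewrite andbA.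
Qed.

Lemma sum_over_card (M : nmodType) (T : finType) (F : nat -> nat -> M) :
  \sum_(A : {set T}) F #|A| #|~: A| =
  \sum_(j < #|T|.+1) F j (#|T| - j)%N *+ 'C(#|T|, j).
Proof.
rewrite (partition_big (fun A : {set T} => inord #|A| : 'I_#|T|.+1) xpredT) //=.
apply: eq_bigr => j _; rewrite (eq_bigr (fun _ => F j (#|T| - j)%N)).
  rewrite sumr_const; congr (_ *+ _); rewrite -card_draws; apply: eq_card => A.
  by rewrite inE unfold_in /= eqnE inordK // ltnS max_card.
move=> A /eqP<-; rewrite inordK ?ltnS ?max_card //.
by congr (F _ _); rewrite -(cardsC A) addKn.
Qed.

(** The previous sum depends on S and T through their cardinals only. *)
Lemma deriv_graph_sum p q :
  (graph_sum 'I_p 'I_q)^`() =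
  \sum_(j < p.+1) \sum_(l < q.+1)
    ((connected_sum 'I_j 'I_l)^`() * graph_sum 'I_(p - j) 'I_(q - l)) *+ ('C(p, j) * 'C(q, l)).
Proof.
rewrite deriv_graph_sum_sets.
have := sum_over_card 'I_p (fun j j' => \sum_(T : {set 'I_q})
    (connected_sum 'I_j 'I_#|T|)^`() * graph_sum 'I_j' 'I_#|~: T|).
rewrite card_ord => ->; apply: eq_bigr => j _.
have := sum_over_card 'I_q (fun l l' =>
    (connected_sum 'I_j 'I_l)^`() * graph_sum 'I_(p - j) 'I_l').
rewrite card_ord => ->; rewrite -sumrMnl; apply: eq_bigr => l _.
by rewrite -mulrnA mulnC.
Qed.
End ExponentialFormula.

(** * The exponential formula *)

Lemma sum_antidiagonals (M : nmodType) n (G : nat -> nat -> M) :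
  \sum_(p < n) \sum_(j < p.+1) G j (p - j)%N =
  \sum_(j < n) \sum_(j' < n | (j + j' < n)%N) G j j'.
Proof.
under eq_bigr => p _.
  rewrite (big_ord_widen n (fun j => G j (p - j)%N)) ?ltn_ord //; over.
rewrite (exchange_big_dep xpredT) //=; apply: eq_bigr => j _.
rewrite -(big_geq_mkord j n xpredT (fun p => G j (p - j)%N)).
rewrite -[X in \big[_/_]_(X <= _ < _) _]add0n big_addn big_mkord.
transitivity (\sum_(k < n - j) G j k); first by apply: eq_bigr => k _; rewrite addnK.
rewrite (big_ord_widen n (fun k => G j k)) ?leq_subr //.
by apply: eq_bigl => k; rewrite ltn_subRL.
Qed.

Lemma sum_antidiagonals_vanish (M : nmodType) n (G : nat -> nat -> M) :
  (forall j j', (n <= j + j')%N -> G j j' = 0) ->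
  \sum_(p < n) \sum_(j < p.+1) G j (p - j)%N = \sum_(j < n) \sum_(j' < n) G j j'.
Proof.
move=> G0; rewrite sum_antidiagonals; apply: eq_bigr => j _.
rewrite big_mkcond; apply: eq_bigr => j' _.
by case: ltnP => // /G0.
Qed.

(** Every vertex has positive order in the main variable and its valence is at most
three times that order, because n <= 3 (2g - 2 + n) for stable (g, n).  So
only graphs with at most N vertices and 3N half-edges matter up to order N. *)
Section ExponentialFormulaTruncated.
Variables (R : comNzRingType) (rho : {rmorphism rat -> R}).
Variables (x : R) (Phi : nat -> {poly R}).
Hypothesis Phi_low : forall n i, (i == 0)%N || (3 * i < n)%N -> (Phi n)`_i = 0.

Definition graph_term p q := rho ((p`! * q`!)%:R^-1) *: graph_sum x Phi 'I_p 'I_q.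
Definition connected_term p q := rho ((p`! * q`!)%:R^-1) *: connected_sum x Phi 'I_p 'I_q.

Definition graph_series N := \sum_(p < N.+1) \sum_(q < (3 * N).+1) graph_term p q.
Definition connected_series N := \sum_(p < N.+1) \sum_(q < (3 * N).+1) connected_term p q.

Lemma coef_prod_low (I : eqType) (r : seq I) (d : I -> nat) i :
  (i < size r)%N || (3 * i < \sum_(v <- r) d v)%N -> (\prod_(v <- r) Phi (d v))`_i = 0.
Proof.
elim: r i => [|v r IH] i; first by rewrite big_nil ltn0.
rewrite !big_cons /= => lo; rewrite coefM big1 // => j _.
have ltj := ltn_ord j.
case lo1: ((nat_of_ord j == 0)%N || (3 * j < d v)%N); first by rewrite Phi_low ?mul0r.
rewrite IH ?mulr0 //; lia.
Qed.

Lemma sum_degree (V H : finType) (e : {ffun H -> V}) : (\sum_v degree e v = #|H|)%N.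
Proof.
rewrite /degree; under eq_bigr do rewrite card_sum_nat.
rewrite exchange_big /= -sum1_card; apply: eq_bigr => h _.
rewrite (bigD1 (e h)) //= eqxx big1 ?addn0 // => v /negbTE ev.
by rewrite eq_sym ev.
Qed.

Lemma coef_graph_low (V H : finType) (G : lgraph V H) i :
  (i < #|V|)%N || (3 * i < #|H|)%N ->
  ((x ^+ nfix G.2)%:P * \prod_v Phi (degree G.1 v))`_i = 0.
Proof.
move=> lo; rewrite coefCM coef_prod_low ?mulr0 //.
by rewrite sum_degree -sum1_size sum1_card.
Qed.

Lemma coef_graph_term_low p q i :
  (i < p)%N || (3 * i < q)%N -> (graph_term p q)`_i = 0.
Proof.
move=> lo; rewrite coefZ coef_sum big1 ?mulr0 // => G _.
by rewrite coef_graph_low ?card_ord.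
Qed.

Lemma coef_connected_term_low p q i :
  (i < p)%N || (3 * i < q)%N -> (connected_term p q)`_i = 0.
Proof.
move=> lo; rewrite coefZ coef_sum big1 ?mulr0 // => G _.
by rewrite coef_graph_low ?card_ord.
Qed.

Lemma deriv_graph_term p q :
  (graph_term p q)^`() =
  \sum_(j < p.+1) \sum_(l < q.+1) (connected_term j l)^`() * graph_term (p - j) (q - l).
Proof.
rewrite derivZ deriv_graph_sum scaler_sumr; apply: eq_bigr => j _.
rewrite scaler_sumr; apply: eq_bigr => l _.
rewrite derivZ -scalerAl -scalerAr scalerA -scalerMnr scalerMnl; congr (_ *: _).
rewrite -rmorphMn -rmorphM; congr (rho _).
have [lej lel] : (j <= p)%N /\ (l <= q)%N by split; rewrite -ltnS.
have facU n : n`!%:R != 0 :> rat by rewrite pnatr_eq0 -lt0n fact_gt0.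
rewrite -(bin_fact lej) -(bin_fact lel) -[LHS]mulr_natr !natrM.
have binU n m : (m <= n)%N -> 'C(n, m)%:R != 0 :> rat.
  by rewrite pnatr_eq0 -lt0n bin_gt0.
by field; rewrite !facU !binU.
Qed.

Lemma connected_series_coef0 N : (connected_series N)`_0 = 0.
Proof.
rewrite coef_sum big1 // => p _; rewrite coef_sum big1 // => q _.
case: (posnP p) => [p0 | p0]; last by rewrite coef_connected_term_low ?p0.
rewrite coefZ coef_sum big1 ?mulr0 // => -[e s] /andP[_ /is_componentP[/set0Pn[v]]].
by have := leq_trans (ltn_ord v) (eq_leq p0).
Qed.

(** The exponential formula.  Dividing by factorials turns the binomial
convolution of deriv_graph_sum into a Cauchy product; the terms of the product
of the truncated sums that exceed the cutoffs have order at least N. *)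
Lemma graph_series_solves N : solves_exp_ode N (connected_series N) (graph_series N).
Proof.
split.
  rewrite coef_sum big_ord_recl [X in _ + X]big1 ?addr0 => [|p _]; last first.
    by rewrite coef_sum big1 // => q _; rewrite coef_graph_term_low.
  rewrite coef_sum big_ord_recl [X in _ + X]big1 ?addr0 => [|q _]; last first.
    by rewrite coef_graph_term_low.
  pose G0 : lgraph 'I_0 'I_0 := ([ffun h => h], [ffun h => h]).
  rewrite coefZ /graph_sum (big_pred1 G0) => [|[e s]].
    rewrite big_ord0 mulr1 coefC /= /nfix eq_card0 => [|[]//].
    by rewrite expr0 mulr1 mul1n fact0 invr1 rmorph1.
  transitivity true; first by apply/forallP=> -[].
  by apply/esym/eqP; congr pair; apply/ffunP=> -[].
move=> i iN.
pose g j l j' l' := ((connected_term j l)^`() * graph_term j' l')`_i.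
have g0 j l j' l' : (N < j + j')%N || (3 * N < l + l')%N -> g j l j' l' = 0.
  move=> big; rewrite /g coefM big1 // => k _; have ltk := ltn_ord k.
  case lo: ((k.+1 < j)%N || (3 * k.+1 < l)%N).
    by rewrite coef_deriv coef_connected_term_low ?mul0rn ?mul0r.
  rewrite coef_graph_term_low ?mulr0 //; lia.
transitivity (\sum_(p < N.+1) \sum_(j < p.+1)
    \sum_(q < (3 * N).+1) \sum_(l < q.+1) g j l (p - j)%N (q - l)%N).
  rewrite /graph_series linear_sum coef_sum; apply: eq_bigr => p _.
  rewrite linear_sum coef_sum exchange_big; apply: eq_bigr => q _ /=.
  rewrite deriv_graph_term coef_sum; apply: eq_bigr => j _.
  by rewrite coef_sum.
rewrite (sum_antidiagonals_vanish (G := fun j j' =>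
    \sum_(q < (3 * N).+1) \sum_(l < q.+1) g j l j' (q - l)%N)); last first.
  by move=> j j' big; rewrite big1 // => q _; rewrite big1 // => l _; rewrite g0 ?big.
rewrite linear_sum mulr_suml coef_sum; apply: eq_bigr => j _.
rewrite linear_sum mulr_suml coef_sum /=.
under [RHS]eq_bigr do rewrite mulr_sumr coef_sum.
rewrite [RHS]exchange_big /=; apply: eq_bigr => j' _.
under [RHS]eq_bigr do rewrite mulr_sumr coef_sum.
rewrite (sum_antidiagonals_vanish (G := fun l l' => g j l j' l')) // => l l' big.
by rewrite g0 ?big ?orbT.
Qed.
End ExponentialFormulaTruncated.

(** * Involutions and the iterated Leibniz rule *)

Definition involution_poly (q : nat) : {poly rat} :=
  \sum_(s : {ffun 'I_q -> 'I_q} | is_involution s) 'X^(nfix s).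

Section InvolutionExtension.
Variable q : nat.
Implicit Types (s : {ffun 'I_q -> 'I_q}) (r : {ffun 'I_q.+1 -> 'I_q.+1}).

(** An involution of q + 1 points is determined by the image k of the first point
and an involution of the others: if k is one of them, say p, the latter is
made to fix p, and p is rerouted to the first point. *)
Definition extend_flip (k : 'I_q.+1) s : {ffun 'I_q.+1 -> 'I_q.+1} :=
  [ffun h => if unlift ord0 h is Some j then
               if lift ord0 j == k then ord0 else lift ord0 (s j)
             else k].

Definition restrict_flip r : {ffun 'I_q -> 'I_q} :=
  [ffun j => odflt j (unlift ord0 (r (lift ord0 j)))].

Lemma extend_flip0 k s : extend_flip k s ord0 = k.
Proof. by rewrite ffunE unlift_none. Qed.

Lemma extend_flip_lift k s j :
  extend_flip k s (lift ord0 j) = if lift ord0 j == k then ord0 else lift ord0 (s j).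
Proof. by rewrite ffunE liftK. Qed.

Lemma extend_flip_ord0_lift s j : extend_flip ord0 s (lift ord0 j) = lift ord0 (s j).
Proof. by rewrite extend_flip_lift eq_sym (negbTE (neq_lift _ _)). Qed.

Lemma restrict_flipK k r : is_involution r -> r ord0 == k ->
  extend_flip k (restrict_flip r) = r.
Proof.
move=> /forallP sK /eqP s0; apply/ffunP=> h; rewrite ffunE.
case: unliftP => [j -> | -> //]; case: eqP => [-> | neq].
  by rewrite -s0 (eqP (sK _)).
rewrite ffunE; case: unliftP => [j' -> // | sj].
by case: neq; have := sK (lift ord0 j); rewrite sj s0 => /eqP.
Qed.

Lemma extend_flip_ord0P s :
  [&& is_involution (extend_flip ord0 s), extend_flip ord0 s ord0 == ord0
    & restrict_flip (extend_flip ord0 s) == s] = is_involution s.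
Proof.
have extE := extend_flip_ord0_lift s.
apply/and3P/forallP=> [[/forallP sK _ _] j | sK].
  by have := sK (lift ord0 j); rewrite !extE (inj_eq lift_inj).
split; last by apply/eqP/ffunP=> j; rewrite ffunE extE liftK.
  apply/forallP=> h; case: (unliftP ord0 h) => [j -> | ->]; last by rewrite !extend_flip0.
  by rewrite !extE (eqP (sK j)).
by rewrite extend_flip0.
Qed.

Lemma extend_flip_liftP p s :
  [&& is_involution (extend_flip (lift ord0 p) s),
      extend_flip (lift ord0 p) s ord0 == lift ord0 p
    & restrict_flip (extend_flip (lift ord0 p) s) == s] = is_involution s && (s p == p).
Proof.
have extE j : extend_flip (lift ord0 p) s (lift ord0 j) =
    if j == p then ord0 else lift ord0 (s j).
  by rewrite extend_flip_lift (inj_eq lift_inj).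
apply/and3P/andP=> [[/forallP sK _ /eqP/ffunP sE] | [/forallP sK /eqP sp]].
  have sp : s p = p by rewrite -sE ffunE extE eqxx unlift_none.
  split; last by rewrite sp.
  apply/forallP=> j; case: (eqVneq j p) => [-> | jp]; first by rewrite !sp.
  have := sK (lift ord0 j); rewrite !extE (negbTE jp) extE.
  case: (eqVneq (s j) p) => _; last by rewrite (inj_eq lift_inj).
  by rewrite (negbTE (neq_lift _ _)).
split; last 2 first.
- by rewrite extend_flip0.
- apply/eqP/ffunP=> j; rewrite ffunE extE.
  by case: eqP => [-> | _]; rewrite ?unlift_none ?liftK ?sp.
apply/forallP=> h; case: (unliftP ord0 h) => [j -> | ->]; last first.
  by rewrite extend_flip0 extE eqxx.
rewrite extE; case: (eqVneq j p) => [-> | jp]; first by rewrite extend_flip0.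
rewrite extE ifN ?(eqP (sK j)) //.
by apply: contra jp => /eqP sj; rewrite -(eqP (sK j)) sj sp.
Qed.

Lemma nfix_extend_ord0 s : nfix (extend_flip ord0 s) = (nfix s).+1.
Proof.
rewrite /nfix !card_sum_nat big_ord_recl /= extend_flip0 eqxx add1n; congr _.+1.
by apply: eq_bigr => j _; rewrite /= extend_flip_ord0_lift (inj_eq lift_inj).
Qed.

Lemma nfix_extend_lift p s : s p == p -> nfix (extend_flip (lift ord0 p) s) = (nfix s).-1.
Proof.
move=> sp; rewrite /nfix !card_sum_nat big_ord_recl /= extend_flip0.
rewrite eq_sym (negbTE (neq_lift _ _)) add0n [in RHS](bigD1 p) //= sp add1n /=.
rewrite (bigD1 p) //= extend_flip_lift eqxx (negbTE (neq_lift _ _)) add0n.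
apply: eq_bigr => j jp; rewrite /= extend_flip_lift (inj_eq lift_inj) (negbTE jp).
by rewrite (inj_eq lift_inj).
Qed.
End InvolutionExtension.

(** The first point is either fixed or paired with another point p; forgetting the
pairing leaves an involution with a distinguished fixed point p, and
distinguishing a fixed point is differentiation. *)
Lemma involution_polyS q :
  involution_poly q.+1 = 'X * involution_poly q + (involution_poly q)^`().
Proof.
rewrite {1}/involution_poly (partition_big (fun s : {ffun 'I_q.+1 -> 'I_q.+1} => s ord0) xpredT) //= big_ord_recl.
congr (_ + _).
  rewrite (reindex_onto (extend_flip ord0) (@restrict_flip q)) => [|s /andP[]]; last first.
    exact: restrict_flipK.
  rewrite mulr_sumr; apply: eq_big => [s | s _]; last by rewrite nfix_extend_ord0 exprS.
  by rewrite -andbA extend_flip_ord0P.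
transitivity (\sum_(p < q) \sum_(s : {ffun 'I_q -> 'I_q} | is_involution s && (s p == p))
    ('X^((nfix s).-1) : {poly rat})).
  apply: eq_bigr => p _.
  rewrite (reindex_onto (extend_flip (lift ord0 p)) (@restrict_flip q)) => [|s /andP[]];
    last exact: restrict_flipK.
  apply: eq_big => [s | s]; first by rewrite -andbA extend_flip_liftP.
  by rewrite -andbA extend_flip_liftP => /andP[_ sp]; rewrite nfix_extend_lift.
rewrite (exchange_big_dep (@is_involution _)) /=; last by move=> p s _ /andP[].
rewrite linear_sum; apply: eq_bigr => s sI /=.
rewrite derivXn /nfix -sumr_const; apply: eq_bigl => p.
by rewrite inE sI.
Qed.

Lemma graph_sum_factor (R : comNzRingType) (x : R) (Phi : nat -> {poly R}) (V H : finType) :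
  graph_sum x Phi V H =
  (\sum_(s : {ffun H -> H} | is_involution s) x ^+ nfix s)%:P *
  \sum_(e : {ffun H -> V}) \prod_v Phi (degree e v).
Proof.
rewrite /graph_sum rmorph_sum /= mulr_sumr; under [RHS]eq_bigr do rewrite mulr_suml.
by rewrite pair_big.
Qed.

(** Each of the q derivatives chooses the factor that it hits, which is a map e;
a factor is differentiated as many times as it is chosen. *)
Lemma derivn_prod (R : comNzRingType) (V : finType) (F : V -> {poly R}) q :
  (\prod_v F v)^`(q) =
  \sum_(e : {ffun 'I_q -> V}) \prod_v (F v)^`(degree e v).
Proof.
have deg0 (e : {ffun 'I_0 -> V}) v : degree e v = 0%N by apply: eq_card0 => -[].
elim: q => [|q IH].
  have e0 : {ffun 'I_0 -> V} by apply: finfun => -[].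
  rewrite derivn0 (big_pred1 e0) => [|e]; first by apply: eq_bigr => v _; rewrite deg0.
  by apply/esym/eqP/ffunP=> -[].
rewrite derivnS IH linear_sum /=.
under eq_bigr => e _.
  have -> : \prod_v (F v)^`(degree e v) = \prod_(v in [set: V]) (F v)^`(degree e v).
    by apply: eq_bigl => v; rewrite inE.
  rewrite deriv_prod; over.
rewrite pair_big_dep /=.
pose cons_end (ev : {ffun 'I_q -> V} * V) : {ffun 'I_q.+1 -> V} :=
  [ffun h => if unlift ord0 h is Some j then ev.1 j else ev.2].
pose uncons_end (e : {ffun 'I_q.+1 -> V}) : {ffun 'I_q -> V} * V :=
  ([ffun j => e (lift ord0 j)], e ord0).
have cons_lift ev j : cons_end ev (lift ord0 j) = ev.1 j by rewrite ffunE liftK.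
have cons0 ev : cons_end ev ord0 = ev.2 by rewrite ffunE unlift_none.
rewrite [RHS](reindex cons_end) /=; last first.
  exists uncons_end => [[e v] | e] _.
    by congr pair; [apply/ffunP=> j; rewrite ffunE cons_lift | rewrite cons0].
  by apply/ffunP=> h; case: (unliftP ord0 h) => [j -> | ->]; rewrite !ffunE ?liftK ?unlift_none ?ffunE.
apply: eq_big => [[e v] | [e v] _] /=; first by rewrite inE.
have degE u : degree (cons_end (e, v)) u = ((v == u) + degree e u)%N.
  rewrite /degree !card_sum_nat big_ord_recl /= cons0; congr (_ + _)%N.
  by apply: eq_bigr => j _; rewrite /= cons_lift.
rewrite [RHS](bigD1 v) //= degE eqxx derivnS; congr (_ * _).
apply: eq_big => [u | u /andP[_ uv]]; first by rewrite inE.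
by rewrite degE eq_sym (negbTE uv).
Qed.

(** * Wick's theorem and the formal Gaussian integral *)

Section Wick.
Variable phi : nat -> {poly rat}.

(** The outer variable is the order t and the inner one is x; the coefficients
phi n of x^n are polynomials in t, whence the exchange of variables. *)
Definition vertex_series N : {poly {poly rat}} :=
  swapXY (\poly_(n < (3 * N).+1) (n`!%:R^-1 *: phi n)).

(** Leibniz rule for the p-th power of the vertex series, evaluated at x = 0. *)
Lemma coef_vertex_exp N p q : (q <= 3 * N)%N ->
  \sum_(e : {ffun 'I_q -> 'I_p}) \prod_v phi (degree e v) =
  ((\poly_(n < (3 * N).+1) (n`!%:R^-1 *: phi n)) ^+ p)`_q *+ q`!.
Proof.
move=> qN; set P := \poly_(n < _) _.
have := congr1 (fun u : {poly {poly rat}} => u`_0) (derivn_prod (fun _ : 'I_p => P) q).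
rewrite prodr_const card_ord coef_derivn addn0 ffactnn => ->.
rewrite coef_sum; apply: eq_bigr => e _.
have -> (F : 'I_p -> {poly {poly rat}}) : (\prod_v F v)`_0 = \prod_v (F v)`_0.
  by rewrite -horner_coef0 horner_prod; apply: eq_bigr => v _; rewrite horner_coef0.
apply: eq_bigr => v _; rewrite coef_derivn addn0 ffactnn coef_poly ltnS.
rewrite (leq_trans _ qN); last by rewrite -[leqRHS]card_ord max_card.
by rewrite scalerMnl -mulr_natr mulVf ?scale1r // pnatr_eq0 -lt0n fact_gt0.
Qed.

(** On q half-edges, pairing them up and attaching them to vertices are independent
choices, so that the sum over graphs factors for each q. *)
Lemma coef_graph_series N b :
  (graph_series polyC 'X (fun n => map_poly polyC (phi n)) N)`_b =
  \sum_(q < (3 * N).+1) (pexp polyC N (vertex_series N))`_b`_q *: involution_poly q.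
Proof.
rewrite /graph_series exchange_big coef_sum; apply: eq_bigr => q _ /=.
rewrite /pexp !coef_sum scaler_suml; apply: eq_bigr => p _.
rewrite coefZ graph_sum_factor coefCM -/(involution_poly q) coefZ coefCM.
have -> : \sum_(e : {ffun 'I_q -> 'I_p}) \prod_v map_poly polyC (phi (degree e v)) =
    map_poly polyC (\sum_(e : {ffun 'I_q -> 'I_p}) \prod_v phi (degree e v)).
  by rewrite rmorph_sum /=; apply: eq_bigr => e _; rewrite rmorph_prod.
have qN : (q <= 3 * N)%N by rewrite -ltnS.
rewrite (coef_vertex_exp _ qN) coef_map coefMn /=.
rewrite /vertex_series -rmorphXn /= coef_swapXY.
rewrite mulrCA mulrC mul_polyC -mul_polyC -rmorphM /= mul_polyC; congr (_ *: _).
rewrite natrM invfM -mulrA; congr (_ * _).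
by rewrite -[X in _ * X]mulr_natl mulrA mulVf ?mul1r // pnatr_eq0 -lt0n fact_gt0.
Qed.
End Wick.

Definition gauss_functional (p : {poly rat}) : rat := \sum_(k < size p) gauss_moment k * p`_k.

Lemma gauss_functional_widen n (p : {poly rat}) : (size p <= n)%N ->
  gauss_functional p = \sum_(k < n) gauss_moment k * p`_k.
Proof.
move=> sn; rewrite /gauss_functional (big_ord_widen n (fun k => gauss_moment k * p`_k)) //.
rewrite big_mkcond; apply: eq_bigr => k _; case: ltnP => // sk.
by rewrite nth_default ?mulr0.
Qed.

Lemma gauss_functional_linear : scalar gauss_functional.
Proof.
move=> a p q; pose n := maxn (size p) (size q).
rewrite (@gauss_functional_widen n (a *: p + q)); last first.
  by rewrite (leq_trans (size_polyD _ _)) // geq_max leq_maxr (leq_trans (size_scale_leq _ _)) ?leq_maxl.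
rewrite (@gauss_functional_widen n p) ?leq_maxl // (@gauss_functional_widen n q) ?leq_maxr //.
rewrite mulr_sumr -big_split; apply: eq_bigr => k _ /=.
by rewrite coefD coefZ mulrDr mulrCA.
Qed.

HB.instance Definition _ :=
  GRing.isLinear.Build rat {poly rat} rat *%R gauss_functional gauss_functional_linear.

Lemma gauss_momentS k : gauss_moment k.+2 = - (k.+1%:R * gauss_moment k).
Proof.
rewrite /gauss_moment /= negbK; case: ifP => [|/negbT even_k]; first by rewrite mulr0 oppr0.
rewrite big_ord_recr exprS /= natrM mulN1r mulNr; congr (- _).
have -> : (2 * k./2 + 1 = k.+1)%N.
  by rewrite mul2n addn1 -[in RHS](odd_double_half k) (negbTE even_k).
by rewrite mulrA mulrC.
Qed.

(** Integration by parts against exp(x^2/2), from (k+1)!! = (k+1) (k-1)!!. *)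
Lemma gauss_functionalXM p : gauss_functional ('X * p) = - gauss_functional p^`().
Proof.
rewrite (@gauss_functional_widen (size p).+1); last first.
  by rewrite (leq_trans (size_polyMleq _ _)) // size_polyX.
rewrite (@gauss_functional_widen (size p) p^`()); last exact: leq_trans (size_poly _ _) (leq_pred _).
rewrite big_ord_recl coefXM mulr0 add0r -sumrN.
case sp: (size p) => [|n]; first by rewrite !big_ord0.
have pn : p`_n.+1 = 0 by rewrite nth_default ?sp.
rewrite [RHS]big_ord_recr /= coef_deriv pn mul0rn mulr0 oppr0 addr0.
rewrite big_ord_recl /= {1}/gauss_moment /= mul0r add0r.
apply: eq_bigr => i _; rewrite coefXM coef_deriv /= gauss_momentS /bump /= !add1n.
by rewrite mulNr; congr (- _); rewrite mulrnAr -mulrnAl -[in RHS]mulr_natl.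
Qed.

(** * Hermite polynomials invert the sum over involutions *)

(** The coefficients of exp(-x s + s^2/2) in s, by the recurrence coming from
the derivative (-x + s) exp(-x s + s^2/2) in s. *)
Fixpoint hermite_pair (n : nat) : {poly rat} * {poly rat} :=
  if n is m.+1 then
    let: (a, b) := hermite_pair m in (m.+1%:R^-1 *: (b - 'X * a), a)
  else (1, 0).

Definition hermite n := (hermite_pair n).1.

Lemma hermite0 : hermite 0 = 1. Proof. by []. Qed.

Lemma hermite1 : hermite 1 = - 'X.
Proof. by rewrite /hermite /= invr1 scale1r mulr1 sub0r. Qed.

Lemma hermiteSS n : hermite n.+2 *+ n.+2 = hermite n - 'X * hermite n.+1.
Proof.
rewrite /hermite /=; case: (hermite_pair n) => a b /=.
by rewrite scalerMnl -[X in X *: _]mulr_natr mulVf ?scale1r // pnatr_eq0.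
Qed.

Lemma polyMn_inj n (p q : {poly rat}) : p *+ n.+1 = q *+ n.+1 -> p = q.
Proof.
move/(congr1 (fun r => n.+1%:R^-1 *: r)); rewrite /= -!scalerMnr.
by rewrite !scalerMnl -[X in X *: _]mulr_natr -[X in _ = X *: _]mulr_natr mulVf ?scale1r // pnatr_eq0.
Qed.

Lemma deriv_hermite n : (hermite n.+1)^`() = - hermite n.
Proof.
elim/ltn_ind: n => -[|n] IH; first by rewrite hermite1 derivN derivX hermite0.
apply: (@polyMn_inj n.+1); rewrite -derivMn hermiteSS derivB derivM derivX mul1r IH //.
case: n IH => [|n] IH.
  by rewrite hermite0 hermite1 -[1 in X in _ - X]/(1%:P) derivC; ring.
rewrite IH // mulNrn (mulrS (hermite n.+2)) hermiteSS; ring.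
Qed.

Lemma gauss_hermite n : gauss_functional (hermite n) = (n == 0)%:R.
Proof.
have G1 : gauss_functional 1 = 1.
  by rewrite (@gauss_functional_widen 1) ?size_poly1 // big_ord1 coef1 mulr1 /gauss_moment /= big_ord0.
case: n => [|[|n]]; first exact: G1.
  by rewrite hermite1 -['X]mulr1 linearN /= gauss_functionalXM -[1]/(1%:P) derivC linear0 !oppr0.
have : gauss_functional (hermite n.+2) *+ n.+2 = 0.
  by rewrite -linearMn hermiteSS linearB /= gauss_functionalXM deriv_hermite linearN /= opprK subrr.
by move/eqP; rewrite mulrn_eq0 => /eqP.
Qed.

(** Multiplication by x followed by the formal integral is minus the integral of
the derivative; applied to h_n (x u_q + u_q'), the two terms with u_q' cancel and
- h_n' = h_(n-1) remains, so that both indices go down by one. *)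
Lemma gauss_hermite_involution n q :
  gauss_functional (hermite n * involution_poly q) = (n == q)%:R.
Proof.
elim: q n => [|q IH] n.
  have -> : involution_poly 0 = 1.
    rewrite /involution_poly (big_pred1 [ffun h => h]) => [|s].
      by rewrite /nfix eq_card0 => [|[]].
    transitivity true; first by apply/forallP=> -[].
    by apply/esym/eqP/ffunP=> -[].
  by rewrite mulr1 gauss_hermite.
rewrite involution_polyS mulrDr mulrCA linearD /= gauss_functionalXM derivM linearD /=.
rewrite opprD addrNK; case: n => [|n].
  by rewrite hermite0 -[X in X^`()]/(1%:P) derivC mul0r linear0 oppr0.
by rewrite deriv_hermite mulNr linearN /= opprK IH.
Qed.

(** Polynomials in three variables are nested: the outer variable marks the order,
the middle one is y and the inner one is x. *)
Definition rat2 : {rmorphism rat -> {poly {poly rat}}} := polyC \o polyC.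

(** This is -x y z + (y z)^2 / 2; y z is the middle variable times the outer one. *)
Definition shift_exponent : {poly {poly {poly rat}}} :=
  (- ('X%:P * 'X)) *: 'X + (rat2 2^-1 * 'X ^+ 2) *: 'X ^+ 2.

Definition shift_series N : {poly {poly {poly rat}}} :=
  \poly_(w < N.+1) (hermite w *: 'X^w).

Lemma shift_series_solves N : solves_exp_ode N shift_exponent (shift_series N).
Proof.
split; first by rewrite coef_poly /= hermite0 scale1r expr0.
move=> i iN.
have -> : shift_exponent^`() = (- ('X%:P * 'X))%:P + ('X ^+ 2)%:P * 'X.
  rewrite /shift_exponent derivD !derivZ derivX derivXn expr1 /= alg_polyC.
  rewrite -scalerMnr scalerMnl -mulrnAl -(rmorphMn rat2).
  have -> : (2^-1 : rat) *+ 2 = 1 by rewrite -[LHS]mulr_natr mulVf.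
  by rewrite rmorph1 mul1r (mul_polyC ('X ^+ 2)).
rewrite coef_deriv mulrDl coefD coefCM -mulrA coefCM coefXM !coef_poly ltnS iN ltnW //.
case: i iN => [|i] iN /=.
  by rewrite mulr0 addr0 hermite0 hermite1 mulr1n scale1r mulr1 expr1 scaleNr -mul_polyC.
rewrite ifT; last by lia.
rewrite scalerMnl hermiteSS -!mul_polyC rmorphB rmorphM /= !exprS expr0.
move: ('X ^+ i : {poly {poly rat}}) ((hermite i)%:P) ((hermite i.+1)%:P) ('X%:P).
by move=> z a b x; ring.
Qed.

(** * Formal series represented by polynomials *)

Lemma finite_sum_seq (T : choiceType) (A : set T) (r : seq T) (f : T -> rat) :
  uniq r -> (forall i, i \in r -> A i) -> (forall i, A i -> i \notin r -> f i = 0) ->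
  \sum_(i \in A) f i = \sum_(i <- r) f i.
Proof.
move=> r_uniq rA Ar; rewrite (fsbigE r) //.
rewrite big_mkcond; apply: eq_big_seq => i ir.
by rewrite ifT //; apply/mem_set/rA.
Qed.

(** Exponents are pairs of an index j (the exponents of x and y) and an exponent a
of z.  The order wt j - a is additive, nonnegative on all the series below, and
replaces a as an exponent, which makes every convolution a finite sum over the
decompositions dec j of j.  The functional c j extracts the coefficient of
index j. *)
Section Representation.
Variables (J : nmodType) (wt : J -> int) (dec : J -> seq (J * J)).
Hypothesis wtD : forall j k, wt (j + k) = wt j + wt k.
Hypothesis dec_uniq : forall j, uniq (dec j).
Hypothesis mem_dec : forall j d, (d \in dec j) = (d.1 + d.2 == j).

Variables (R : comNzRingType) (rho : {rmorphism rat -> R}) (c : J -> {additive R -> rat}).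
Hypothesis c1 : forall j, c j 1 = (j == 0)%:R.
Hypothesis cZ : forall j a r, c j (rho a * r) = a * c j r.
Hypothesis cM : forall j r s, c j (r * s) = \sum_(d <- dec j) c d.1 r * c d.2 s.

Local Notation M := (J * int)%type.
Implicit Types (f g : fseries M) (P Q : {poly R}).

Definition represents N f P : Prop := forall j a,
  match wt j - a with
  | Posz i => (i <= N)%N -> f (j, a) = c j P`_i
  | Negz _ => f (j, a) = 0
  end.

Lemma representsP N f P :
  (forall j i, (i <= N)%N -> f (j, wt j - Posz i) = c j P`_i) ->
  (forall j a, wt j - a < 0 -> f (j, a) = 0) -> represents N f P.
Proof.
move=> fP fN j a; case E: (wt j - a) => [i | i]; last by apply: fN; rewrite E.
by move=> iN; rewrite -fP //; congr (f (_, _)); rewrite -E; ring.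
Qed.

Lemma represents_coef N f P j i : represents N f P -> (i <= N)%N ->
  f (j, wt j - Posz i) = c j P`_i.
Proof. by move=> /(_ j (wt j - Posz i)); rewrite opprB addrC subrK. Qed.

Lemma represents_neg N f P j a : represents N f P -> wt j - a < 0 -> f (j, a) = 0.
Proof. by move=> /(_ j a); case: (wt j - a). Qed.

Lemma wt0 : wt 0 = 0.
Proof. by apply: (addrI (wt 0)); rewrite -wtD !addr0. Qed.

(** A pair of exponents contributes only if both have nonnegative order, so the
support of the convolution lies in the finite set of splittings of j and of
the order. *)
Lemma representsM N f g P Q :
  represents N f P -> represents N g Q -> represents N (fmul f g) (P * Q).
Proof.
move=> fP gQ; apply: representsP => [j i iN | j a neg]; last first.
  rewrite /fmul fsbig1 // => -[[j1 a1] [j2 a2]] /= [jE aE].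
  move: neg; rewrite -jE -aE wtD => neg.
  case: (ltrP (wt j1 - a1) 0) => [neg1 | pos1].
    by rewrite (represents_neg fP neg1) mul0r.
  rewrite (represents_neg gQ) ?mulr0 //; lia.
(* k is the order of the first factor, i - k that of the second. *)
pose pr (d : J * J) k : M * M :=
  ((d.1, wt d.1 - Posz k), (d.2, wt d.2 - Posz (i - k))).
rewrite /fmul (finite_sum_seq (r := [seq pr d k | d <- dec j, k <- index_iota 0 i.+1])).
- rewrite big_allpairs_dep coefM raddf_sum.
  under [RHS]eq_bigr do rewrite cM.
  rewrite [RHS]exchange_big /=; apply: eq_bigr => d _.
  rewrite big_mkord; apply: eq_bigr => k _.
  have ltk := ltn_ord k.
  by rewrite /pr /= (represents_coef _ fP) ?(represents_coef _ gQ) //; lia.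
- apply: allpairs_uniq => //; first exact: iota_uniq.
  move=> [[d1 d2] k] [[e1 e2] l] _ _ [] /= -> E -> _; congr (_, _, _); lia.
- move=> p /allpairsP[[d k] /= [dj ki ->]]; rewrite /pr /=.
  move: dj ki; rewrite mem_dec mem_index_iota => /eqP <- ki; congr pair.
  by rewrite wtD /= -subzn -1?ltnS //; ring.
move=> [[j1 a1] [j2 a2]] eqM notin.
have [jE aE] : j1 + j2 = j /\ a1 + a2 = wt j - Posz i by case: eqM.
case: (ltrP (wt j1 - a1) 0) => [neg1 | pos1]; first by rewrite (represents_neg fP neg1) mul0r.
case: (ltrP (wt j2 - a2) 0) => [neg2 | pos2]; first by rewrite (represents_neg gQ neg2) mulr0.
case/negP: notin.
have -> : ((j1, a1), (j2, a2)) = pr (j1, j2) `|wt j1 - a1|%N.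
  by rewrite /pr /=; congr ((_, _), (_, _)); move: aE; rewrite -jE wtD; lia.
apply: allpairs_f; first by rewrite mem_dec jE.
by rewrite mem_index_iota; move: aE; rewrite -jE wtD; lia.
Qed.

Lemma represents1 N : represents N (monomial 0) 1.
Proof.
apply: representsP => [j i _ | j a neg]; rewrite /monomial.
  rewrite coef1; case: i => [|i]; first by rewrite c1 xpair_eqE subr0; case: eqP => // ->; rewrite wt0.
  rewrite raddf0 (_ : (_ == _) = false) //.
  by apply/eqP=> -[->]; rewrite wt0.
rewrite (_ : (_ == _) = false) //.
by apply/eqP=> -[j0 a0]; move: neg; rewrite j0 a0 wt0.
Qed.

Lemma representsX N f P k : represents N f P -> represents N (fpow f k) (P ^+ k).
Proof.
move=> fP; elim: k => [|k IH]; first exact: represents1.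
by rewrite exprS; apply: representsM.
Qed.

Lemma representsD N f g P Q :
  represents N f P -> represents N g Q -> represents N (f \+ g) (P + Q).
Proof.
move=> fP gQ; apply: representsP => [j i iN | j a neg] /=.
  by rewrite coefD raddfD (represents_coef _ fP) ?(represents_coef _ gQ).
by rewrite (represents_neg fP neg) (represents_neg gQ neg) addr0.
Qed.

(** The k-th power has order at least k, so the exponential series is a finite sum
at each monomial. *)
Lemma represents_exp N f P : P`_0 = 0 -> represents N f P ->
  represents N (fexp f) (pexp rho N P).
Proof.
move=> P0 fP; apply: representsP => [j i iN | j a neg]; rewrite /fexp /fsum.
  rewrite (finite_sum_seq (r := index_iota 0 N.+1)) ?iota_uniq //; last first.
    move=> k _; rewrite mem_index_iota ltnS /= => kN; rewrite (represents_coef _ (representsX k fP)) //.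
    by rewrite coef_exp_low ?raddf0 ?mulr0 //; lia.
  rewrite big_mkord coef_sum raddf_sum; apply: eq_bigr => k _ /=.
  by rewrite (represents_coef _ (representsX k fP)) // coefZ cZ.
by rewrite fsbig1 // => k _ /=; rewrite (represents_neg (representsX k fP) neg) mulr0.
Qed.
End Representation.

(** * The Euler relation for connected graphs *)

(** A connected graph with p vertices has at least p - 1 edges, by linear algebra: the
functions on vertices that agree at both ends of every edge are constant, so
the kernel of the incidence matrix has dimension at most one. *)
Lemma connected_edge_bound p q (e : {ffun 'I_q -> 'I_p}) (s : {ffun 'I_q -> 'I_q}) :
  is_involution s -> is_connected e s -> (p <= #|[set h : 'I_q | (h < s h)%N]|.+1)%N.
Proof.
move=> /forallP sK /is_componentP[/set0Pn[v0 _] _ conn]; set E := [set h | _].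
pose B : 'M[rat]_(p, #|E|) :=
  \matrix_(v, k) ((v == e (enum_val k))%:R - (v == e (s (enum_val k)))%:R).
have mulB (r : 'rV_p) k : (r *m B) 0 k = r 0 (e (enum_val k)) - r 0 (e (s (enum_val k))).
  have pick u : \sum_v r 0 v * (v == u)%:R = r 0 u.
    by rewrite (bigD1 u) //= eqxx mulr1 big1 ?addr0 // => v /negbTE ->; rewrite mulr0.
  rewrite mxE -(pick (e _)) -(pick (e (s _))) -sumrB; apply: eq_bigr => v _.
  by rewrite mxE mulrBr.
(* By mulB the kernel consists of the functions constant on every component. *)
suff kerB : (kermx B <= (const_mx 1 : 'rV[rat]_p))%MS.
  have := mxrankS kerB; rewrite mxrank_ker => le1.
  have := leq_trans le1 (rank_leq_row _); have := rank_leq_col B; lia.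
apply/row_subP=> i; set r := row i _.
have rB : r *m B = 0 by rewrite -row_mul mulmx_ker row0.
have eq_ends h : r 0 (e h) = r 0 (e (s h)).
  have lt_case (g : 'I_q) : (g < s g)%N -> r 0 (e g) = r 0 (e (s g)).
    move=> gE; have gin : g \in E by rewrite inE.
    have := mulB r (enum_rank_in gin g); rewrite rB mxE enum_rankK_in //.
    by move/esym/eqP; rewrite subr_eq0 => /eqP.
  case: (ltngtP h (s h)) => [/lt_case // | lt | /val_inj <- //].
  by have := lt_case (s h); rewrite (eqP (sK h)) => ->.
have const_r : [set v | r 0 v == r 0 v0] = [set: 'I_p].
  apply: conn; rewrite ?subsetT //; first by apply/set0Pn; exists v0; rewrite inE.
  by apply/edge_closedP=> h; rewrite !inE -eq_ends.
apply/sub_rVP; exists (r 0 v0); apply/rowP=> v.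
have : v \in [set: 'I_p] by rewrite inE.
by rewrite -const_r inE !mxE mulr1 => /eqP.
Qed.

Section GraphEuler.
Variable G : graph.

Definition end_ffun : {ffun 'I_(nhalf G) -> 'I_(nvert G)} := [ffun h => endpoint h].
Definition flip_ffun : {ffun 'I_(nhalf G) -> 'I_(nhalf G)} := [ffun h => flip h].

Lemma flip_ffun_involution : is_involution flip_ffun.
Proof. by apply/forallP=> h; rewrite !ffunE flipK. Qed.

Lemma connected_graphE : connected_graph G = is_connected end_ffun flip_ffun.
Proof.
have adj_sym : connect_sym (@adjacent G).
  apply: sym_connect_sym => u v; apply/existsP/existsP => -[h /andP[hu hv]];
    by exists (flip h); rewrite flipK hu hv.
have adj_closed (Y : {set 'I_(nvert G)}) :
    edge_closed end_ffun flip_ffun Y -> fingraph.closed (@adjacent G) Y.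
  move=> /edge_closedP clY u v /existsP[h /andP[/eqP <- /eqP <-]].
  apply/idP/idP=> hY; first by have := clY h; rewrite !ffunE => ->.
  by have := clY (flip h); rewrite !ffunE flipK => ->.
rewrite /connected_graph /n_components; apply/eqP/is_componentP=> [one | [/set0Pn[v0 _] _ conn]].
  split.
  - have /card_gt0P[v _] : (0 < #|predI (roots (@adjacent G)) predT|)%N.
      by move: one; rewrite /n_comp_mem => ->.
    by apply/set0Pn; exists v; rewrite inE.
  - by apply/edge_closedP=> h _; rewrite inE.
  move=> Y /set0Pn[u uY] _ clY; apply/setP=> v; rewrite inE.
  rewrite -(closed_connect (adj_closed Y clY) (x := u)) // -root_connect //.
  have /card_le1_eqP le1 := eq_leq one.
  by apply/eqP/le1; rewrite inE /= ?roots_root.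
pose Y := [set v | connect (@adjacent G) v0 v].
have YT : Y = setT.
  apply: conn; rewrite ?subsetT //; first by apply/set0Pn; exists v0; rewrite inE.
  apply/edge_closedP=> h; rewrite !inE !ffunE => /connect_trans; apply; apply: connect1.
  by apply/existsP; exists h; rewrite !eqxx.
rewrite -(n_comp_connect adj_sym v0); apply: eq_n_comp_r => v.
have : v \in Y by rewrite YT inE.
by rewrite !inE.
Qed.

Lemma card_moved_half_edges :
  #|[pred h : 'I_(nhalf G) | flip h != h]| =
  (#|[set h : 'I_(nhalf G) | (h < flip_ffun h)%N]|).*2.
Proof.
have -> : #|[set h : 'I_(nhalf G) | (h < flip_ffun h)%N]| =
          #|[pred h : 'I_(nhalf G) | (h < flip h)%N]|.
  by apply: eq_card => h; rewrite !inE ffunE.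
have lt_gt : #|[pred h : 'I_(nhalf G) | (flip h < h)%N]| =
             #|[pred h : 'I_(nhalf G) | (h < flip h)%N]|.
  rewrite !card_sum_nat (reindex_inj (inv_inj (@flipK G))) /=.
  by apply: eq_bigr => h _; rewrite flipK.
rewrite -addnn -{2}lt_gt !card_sum_nat -big_split; apply: eq_bigr => h _ /=.
by rewrite -val_eqE /=; case: ltngtP.
Qed.

Lemma n_internalE : n_internal G = #|[set h : 'I_(nhalf G) | (h < flip_ffun h)%N]|.
Proof. by rewrite /n_internal card_moved_half_edges doubleK. Qed.

Lemma half_edge_count : (nhalf G = 2 * n_internal G + n_external G)%N.
Proof.
rewrite n_internalE mul2n -card_moved_half_edges addnC.
rewrite -[LHS](card_ord (nhalf G)) -(cardC [pred h : 'I_(nhalf G) | flip h == h]).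
by congr (_ + _)%N; apply: eq_card => h; rewrite !inE.
Qed.

(** The exponent of 1/z contributed by the vertices. *)
Definition graph_degree : nat :=
  (\sum_(v < nvert G) (2 * vgenus v + valence v - 2))%N.

(** The Euler relation.  By connected_edge_bound the subtraction in the first Betti
number is exact. *)
Lemma graph_genusE : connected_graph G -> stable_graph G ->
  (2 * graph_genus G + n_external G = graph_degree + 2)%N.
Proof.
move=> conn /forallP stab.
have bound : (nvert G <= n_internal G + 1)%N.
  rewrite n_internalE addn1; apply: (connected_edge_bound (e := end_ffun) flip_ffun_involution).
  by rewrite -connected_graphE.
have sum_val : (\sum_(v < nvert G) valence v = nhalf G)%N.
  rewrite -[RHS]card_ord -(sum_degree end_ffun); apply: eq_bigr => v _.
  by apply: eq_card => h; rewrite !inE ffunE.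
have : (graph_degree + 2 * nvert G = 2 * (\sum_(v < nvert G) vgenus v) + nhalf G)%N.
  rewrite -sum_val big_distrr /= -big_split /= /graph_degree.
  have -> : (2 * nvert G = \sum_(v < nvert G) 2)%N by rewrite sum_nat_const card_ord mulnC.
  rewrite -big_split /=.
  by apply: eq_bigr => v _; have := stab v; rewrite /stable_type; lia.
move: conn; rewrite /connected_graph /graph_genus /betti1 => /eqP ->.
rewrite half_edge_count; lia.
Qed.
End GraphEuler.

(** * Isomorphism classes and labelled graphs *)

Lemma is_isomP (G G' : graph) (phi : graph_map G G') :
  reflect [/\ bijective phi.1, bijective phi.2,
              forall v, vgenus (phi.1 v) = vgenus v,
              forall h, endpoint (phi.2 h) = phi.1 (endpoint h)
            & forall h, flip (phi.2 h) = phi.2 (flip h)] (is_isom phi).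
Proof. exact: asboolP. Qed.

Section IsomorphismInvariants.
Variables (G G' : graph) (phi : graph_map G G').
Hypothesis phi_isom : is_isom phi.

Let bij1 : bijective phi.1. Proof. by case/is_isomP: phi_isom. Qed.
Let bij2 : bijective phi.2. Proof. by case/is_isomP: phi_isom. Qed.

Lemma isom_vgenus v : vgenus (phi.1 v) = vgenus v.
Proof. by case/is_isomP: phi_isom. Qed.

Lemma isom_valence v : valence (phi.1 v) = valence v.
Proof.
case/is_isomP: phi_isom => _ _ _ eE _.
rewrite /valence !card_sum_nat (reindex phi.2 (onW_bij _ bij2)) /=.
by apply: eq_bigr => h _; rewrite eE (inj_eq (bij_inj bij1)).
Qed.

Lemma isom_n_external : n_external G' = n_external G.
Proof.
case/is_isomP: phi_isom => _ _ _ _ sE.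
rewrite /n_external !card_sum_nat (reindex phi.2 (onW_bij _ bij2)) /=.
by apply: eq_bigr => h _; rewrite sE (inj_eq (bij_inj bij2)).
Qed.

Lemma isom_big_vertices (T : Type) (idx : T) (op : Monoid.com_law idx) (F : nat -> nat -> T) :
  \big[op/idx]_(v < nvert G') F (vgenus v) (valence v) =
  \big[op/idx]_(v < nvert G) F (vgenus v) (valence v).
Proof.
rewrite (reindex phi.1 (onW_bij _ bij1)) /=.
by apply: eq_bigr => v _; rewrite isom_vgenus isom_valence.
Qed.

Lemma isom_connected : connected_graph G -> connected_graph G'.
Proof.
case/is_isomP: phi_isom => _ _ _ eE sE.
rewrite !connected_graphE => /is_componentP[/set0Pn[v0 _] _ conn].
apply/is_componentP; split.
- by apply/set0Pn; exists (phi.1 v0); rewrite inE.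
- by apply/edge_closedP=> h _; rewrite inE.
move=> Y /set0Pn[y yY] _ /edge_closedP clY; have [a aK a'K] := bij1.
have preT : [set v | phi.1 v \in Y] = [set: _].
  apply: conn; rewrite ?subsetT //; first by apply/set0Pn; exists (a y); rewrite inE a'K.
  apply/edge_closedP=> h; rewrite !inE !ffunE => hY.
  by have := clY (phi.2 h); rewrite !ffunE eE sE eE; apply.
apply/setP=> v; rewrite inE -(a'K v).
have : a v \in [set: 'I_(nvert G)] by rewrite inE.
by rewrite -preT inE.
Qed.

Lemma isom_inv : exists psi : graph_map G' G,
  [/\ is_isom psi, cancel phi.1 psi.1, cancel psi.1 phi.1, cancel phi.2 psi.2
    & cancel psi.2 phi.2].
Proof.
case/is_isomP: phi_isom => -[a aK a'K] [b bK b'K] gE eE sE.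
exists ([ffun v => a v], [ffun h => b h]); split=> [|v|v|h|h] /=; rewrite ?ffunE //.
apply/is_isomP; split=> /=.
- by exists phi.1 => v; rewrite ffunE.
- by exists phi.2 => h; rewrite ffunE.
- by move=> v; rewrite ffunE -gE a'K.
- by move=> h; rewrite !ffunE -{2}(b'K h) eE aK.
- by move=> h; rewrite !ffunE -{2}(b'K h) sE bK.
Qed.
End IsomorphismInvariants.

Definition graph_map_comp (G1 G2 G3 : graph) (phi : graph_map G2 G3) (psi : graph_map G1 G2) :
  graph_map G1 G3 := ([ffun v => phi.1 (psi.1 v)], [ffun h => phi.2 (psi.2 h)]).

Lemma isom_comp (G1 G2 G3 : graph) (phi : graph_map G2 G3) (psi : graph_map G1 G2) :
  is_isom phi -> is_isom psi -> is_isom (graph_map_comp phi psi).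
Proof.
move=> /is_isomP[B1 B2 gE eE sE] /is_isomP[B1' B2' gE' eE' sE'].
apply/is_isomP; split=> /=.
- by apply: (eq_bij (bij_comp B1 B1')) => v; rewrite ffunE.
- by apply: (eq_bij (bij_comp B2 B2')) => h; rewrite ffunE.
- by move=> v; rewrite ffunE gE gE'.
- by move=> h; rewrite !ffunE eE eE'.
- by move=> h; rewrite !ffunE sE sE'.
Qed.

(** Composition with a fixed isomorphism identifies isomorphisms with automorphisms. *)
Lemma card_isom (G G' : graph) : isomorphic G G' ->
  #|[pred phi : graph_map G G' | is_isom phi]| = card_aut G.
Proof.
case/existsP=> phi phi_isom.
have [psi [psi_isom aK a'K bK b'K]] := isom_inv phi_isom.
have compK : cancel (@graph_map_comp G _ _ phi) (graph_map_comp psi).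
  by move=> [u w]; congr pair; apply/ffunP=> z; rewrite ffunE /= ffunE /= ?aK ?bK.
have compK' : cancel (@graph_map_comp G _ _ psi) (graph_map_comp phi).
  by move=> [u w]; congr pair; apply/ffunP=> z; rewrite ffunE /= ffunE /= ?a'K ?b'K.
rewrite /card_aut !card_sum_nat (reindex (graph_map_comp phi)) /=; last first.
  by exists (graph_map_comp psi) => u _; rewrite ?compK ?compK'.
apply: eq_bigr => u _; congr nat_of_bool; apply/idP/idP; last exact: isom_comp.
by move/(isom_comp psi_isom); rewrite compK.
Qed.

Section LabelledGraphs.
Variable B : nat.

Definition labelled (p q : nat) : finType :=
  ({ffun 'I_p -> 'I_B} * lgraph 'I_p 'I_q)%type.

(** Makes every labelled structure a graph, also when the function is not an
involution; sums are restricted to involutions. *)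
Definition safe_flip q (s : {ffun 'I_q -> 'I_q}) h := if is_involution s then s h else h.

Lemma safe_flipK q (s : {ffun 'I_q -> 'I_q}) : involutive (safe_flip s).
Proof.
move=> h; rewrite /safe_flip; case sI: (is_involution s) => //.
by apply/eqP; exact: (forallP sI).
Qed.

Definition to_graph p q (L : labelled p q) : graph :=
  @Graph p q (fun v => L.1 v) (fun h => L.2.1 h) (safe_flip L.2.2) (@safe_flipK q L.2.2).

(** Orbit-stabiliser for the relabellings of G: count in two ways the pairs of a
labelled graph and an isomorphism from G to it.  Such a pair amounts to a pair
of permutations, of the vertices and of the half-edges, which determines the
labelled graph. *)
Lemma card_labellings (G : graph) : (forall v : 'I_(nvert G), (vgenus v < B)%N) ->
  (#|[pred L : labelled (nvert G) (nhalf G) |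
       is_involution L.2.2 && isomorphic G (to_graph L)]| * card_aut G)%N =
  ((nvert G)`! * (nhalf G)`!)%N.
Proof.
move=> genB; set p := nvert G; set q := nhalf G.
pose m (L : labelled p q) (phi : graph_map G (to_graph L)) : bool :=
  is_involution L.2.2 && is_isom phi.
transitivity (\sum_(L : labelled p q) \sum_(phi : {ffun 'I_p -> 'I_p} * {ffun 'I_q -> 'I_q})
   (is_involution L.2.2 && @is_isom G (to_graph L) phi))%N.
  rewrite card_sum_nat big_distrl /=; apply: eq_bigr => L _.
  case: (is_involution _) => /=; last by rewrite big1.
  case iso : (isomorphic _ _); first by rewrite mul1n -(card_isom iso) card_sum_nat.
  rewrite big1 // => phi _; case isoP: (is_isom _) => //.
  by move/negbT/existsPn/(_ phi)/negP: iso.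
rewrite exchange_big /=.
transitivity (\sum_(phi : {ffun 'I_p -> 'I_p} * {ffun 'I_q -> 'I_q})
   (injectiveb phi.1 && injectiveb phi.2))%N; last first.
  have fact_inj k : k`! = #|[set f : {ffun 'I_k -> 'I_k} | injectiveb f]|.
    by rewrite card_inj_ffuns card_ord ffactnn.
  rewrite -card_sum_nat !fact_inj -cardsX.
  by apply: eq_card => -[u w]; rewrite !inE.
apply: eq_bigr => -[u w] _ /=.
case inj: (_ && _); last first.
  rewrite big1 // => L _; case: andP => // -[_ /is_isomP[/= /bij_inj/injectiveP i1 /bij_inj/injectiveP i2 _ _ _]].
  by rewrite i1 i2 in inj.
case/andP: inj => /injectiveP/injF_bij[a aK a'K] /injectiveP/injF_bij[b bK b'K].
(* For bijections u and w the labelled graph is G transported along them. *)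
pose L0 : labelled p q := ([ffun v => Ordinal (genB (a v))],
  ([ffun h => u (endpoint (b h))], [ffun h => w (flip (b h))])).
have sI : is_involution L0.2.2 by apply/forallP=> h; rewrite !ffunE bK flipK b'K.
rewrite (bigD1 L0) //= big1 => [|L neqL].
  rewrite addn0 sI (_ : is_isom _) //; apply/is_isomP; split=> /=.
  - by exists a.
  - by exists b.
  - by move=> v; rewrite ffunE /= aK.
  - by move=> h; rewrite ffunE bK.
  - by move=> h; rewrite /safe_flip sI ffunE bK.
case: andP => // -[LI /is_isomP[/= _ _ gE eE sE]]; case/eqP: neqL.
case: L LI gE eE sE => [g [e s]] /= LI gE eE sE; congr (_, (_, _)); apply/ffunP=> z.
- by apply: val_inj; rewrite ffunE /= -gE a'K.
- by rewrite ffunE -eE b'K.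
by rewrite ffunE -sE b'K /safe_flip LI.
Qed.

(** Group the labelled graphs by isomorphism class and apply card_labellings to a
representative of each class. *)
Lemma sum_graph_classes (P : graph -> bool) (F : graph -> rat) (m n : nat) :
  (forall G G', isomorphic G G' -> P G = P G') ->
  (forall G G', isomorphic G G' -> F G = F G') ->
  (forall G, P G -> [/\ (nvert G < m)%N, (nhalf G < n)%N
                      & forall v : 'I_(nvert G), (vgenus v < B)%N]) ->
  \sum_(c \in [set c : graph_class | P (repr c)]%classic)
    (card_aut (repr c))%:R^-1 * F (repr c) =
  \sum_(p < m) \sum_(q < n) (p`! * q`!)%:R^-1 *
    \sum_(L : labelled p q | is_involution L.2.2 && P (to_graph L)) F (to_graph L).
Proof.
move=> P_iso F_iso P_bound.
have class_iso (G : graph) c : (\pi_graph_class%qT G == c) = isomorphic (repr c) G.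
  by rewrite -{1}(reprK c) eqmodE isomorphic_sym.
pose cond p q (L : labelled p q) := is_involution L.2.2 && P (to_graph L).
pose s := undup (flatten [seq flatten [seq
  [seq \pi_graph_class%qT (to_graph L) | L <- [seq L <- enum (labelled p q) | cond p q L]]
  | q <- index_iota 0 n] | p <- index_iota 0 m]).
have in_s p q (L : labelled p q) : (p < m)%N -> (q < n)%N -> cond p q L ->
    \pi_graph_class%qT (to_graph L) \in s.
  move=> pm qn cL; rewrite mem_undup; apply/flatten_mapP; exists p.
    by rewrite mem_index_iota.
  apply/flatten_mapP; exists q; first by rewrite mem_index_iota.
  by apply: map_f; rewrite mem_filter cL mem_enum.
have sP c : c \in s -> P (repr c).
  rewrite mem_undup => /flatten_mapP[p _ /flatten_mapP[q _ /mapP[L]]].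
  rewrite mem_filter => /andP[/andP[_ PL] _] /eqP.
  by rewrite eq_sym class_iso => /P_iso ->.
have labelling (G : graph) : P G -> exists L : labelled (nvert G) (nhalf G),
    is_involution L.2.2 /\ isomorphic G (to_graph L).
  case/P_bound=> _ _ gB; have := card_labellings gB.
  case: (pickP [pred L : labelled (nvert G) (nhalf G) |
       is_involution L.2.2 && isomorphic G (to_graph L)]) => [L /andP[LI LG] _ | /eq_card0 ->].
    by exists L.
  by move/esym/eqP; rewrite mul0n muln_eq0 !eqn0Ngt !fact_gt0.
rewrite (finite_sum_seq (r := s)) ?undup_uniq //; first last.
  move=> c /= Pc /negP[]; have [L [LI LG]] := labelling _ Pc.
  have [mG nG _] := P_bound _ Pc.
  have /eqP <- : \pi_graph_class%qT (to_graph L) == c by rewrite class_iso.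
  by apply: in_s => //; rewrite /cond LI -(P_iso _ _ LG).
transitivity (\sum_(c <- s) \sum_(p < m) \sum_(q < n) (p`! * q`!)%:R^-1 *
  \sum_(L : labelled p q | is_involution L.2.2 && isomorphic (repr c) (to_graph L)) F (repr c)).
  apply: eq_big_seq => c /sP Pc; have [mG nG gB] := P_bound _ Pc.
  set G := repr c in Pc mG nG gB *.
  have no_iso p q (L : labelled p q) : isomorphic G (to_graph L) -> p = nvert G /\ q = nhalf G.
    case/existsP=> phi /is_isomP[/bij_eq_card /= b1 /bij_eq_card /= b2 _ _ _].
    by rewrite !card_ord in b1 b2.
  rewrite (bigD1 (Ordinal mG)) //= (bigD1 (Ordinal nG)) //=.
  rewrite [X in _ + X]big1 ?addr0 => [|p /eqP neq]; last first.
    rewrite big1 // => q _; rewrite big_pred0 ?mulr0 // => L.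
    by apply/negP=> /andP[_ /no_iso[eqp _]]; apply: neq; apply: val_inj.
  rewrite [X in _ + X]big1 ?addr0 => [|q /eqP neq]; last first.
    rewrite big_pred0 ?mulr0 // => L; apply/negP=> /andP[_ /no_iso[_ eqq]].
    by apply: neq; apply: val_inj.
  rewrite sumr_const -[X in _ = _ * X]mulr_natl mulrA; congr (_ * _).
  rewrite -(card_labellings gB) natrM invfM -mulrA mulrC -mulrA mulfV ?mulr1 //.
  have := card_labellings gB; rewrite pnatr_eq0 => cardE.
  apply/negP=> /eqP card0; move: cardE; rewrite card0 mul0n => /esym/eqP.
  by rewrite muln_eq0 !eqn0Ngt !fact_gt0.
rewrite exchange_big /=; apply: eq_bigr => p _.
rewrite exchange_big /=; apply: eq_bigr => q _.
rewrite -mulr_sumr; congr (_ * _).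
transitivity (\sum_(c <- s) \sum_(L : labelled p q |
    cond p q L && (\pi_graph_class%qT (to_graph L) == c)) F (to_graph L)).
  apply: eq_big_seq => c /sP Pc; apply: eq_big => [L | L /andP[_ /F_iso] //].
  rewrite class_iso /cond -andbA; case iso: (isomorphic _ _); rewrite ?andbF ?andbT //.
  by rewrite -(P_iso _ _ iso) Pc !andbT.
rewrite (exchange_big_dep (cond p q)) /= => [|c L _ /andP[] //].
apply: eq_bigr => L cL; rewrite (eq_bigl (pred1 (\pi_graph_class%qT (to_graph L)))).
  by rewrite -big_filter filter_pred1_uniq ?undup_uniq ?in_s // big_seq1.
by move=> c; rewrite cL /= eq_sym.
Qed.
End LabelledGraphs.

(** * The connected series and chi of the compactified moduli spaces *)

(** A stable vertex of order at most N has 2g <= N + 2. *)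
Definition genus_bound N := N.+3.

Definition vertex_poly N n : {poly rat} :=
  \sum_(g < genus_bound N | stable_type g n) chiM g n *: 'X^(2 * g + n - 2).

Definition vertex_polyXY N n : {poly {poly rat}} := map_poly polyC (vertex_poly N n).

Lemma coef_vertex_poly_low N n i : (i == 0)%N || (3 * i < n)%N -> (vertex_poly N n)`_i = 0.
Proof.
move=> lo; rewrite coef_sum big1 // => g; rewrite /stable_type => st.
rewrite coefZ coefXn (_ : (i == _) = false) ?mulr0 //; lia.
Qed.

Lemma coef_vertex_polyXY_low N n i : (i == 0)%N || (3 * i < n)%N -> (vertex_polyXY N n)`_i = 0.
Proof. by move=> lo; rewrite coef_map /= coef_vertex_poly_low. Qed.

Section ConnectedSeries.
Variables (N i k : nat).
Local Notation B := (genus_bound N).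

(** For given i and k this is the condition of being a stable graph of type (g, k)
with 2g - 2 + k = i (stable_graph_of_degreeE), phrased without the genus of the
graph so that it can be read off vertex by vertex. *)
Definition stable_graph_of_degree (G : graph) : bool :=
  [&& connected_graph G, stable_graph G, n_external G == k & graph_degree G == i].

Definition graph_chiM (G : graph) : rat := \prod_(v < nvert G) chiM (vgenus v) (valence v).

Lemma coef_prod_vertex_poly (V H : finType) (e : {ffun H -> V}) :
  (\prod_v vertex_poly N (degree e v))`_i =
  \sum_(ga : {ffun V -> 'I_B} | [forall v, stable_type (ga v) (degree e v)]
        && (\sum_v (2 * ga v + degree e v - 2) == i)%N)
    \prod_v chiM (ga v) (degree e v).
Proof.
have -> : \prod_v vertex_poly N (degree e v) =
    \sum_(ga : {ffun V -> 'I_B} | [forall v, stable_type (ga v) (degree e v)])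
      \prod_v (chiM (ga v) (degree e v) *: 'X^(2 * ga v + degree e v - 2)).
  rewrite /vertex_poly bigA_distr_big_dep; apply: eq_bigl => ga.
  by apply/familyP/forallP.
rewrite coef_sum [RHS]big_mkcondr; apply: eq_bigr => ga _.
rewrite scaler_prod coefZ.
have -> : \prod_v 'X^(2 * ga v + degree e v - 2) =
    'X^(\sum_v (2 * ga v + degree e v - 2)) :> {poly rat}.
  by rewrite -expr_sum.
by rewrite coefXn eq_sym; case: eqP; rewrite ?mulr1 ?mulr0.
Qed.

(** Expanding the vertex weights amounts to choosing a genus for each vertex. *)
Lemma coef_connected_sum p q :
  (connected_sum 'X (vertex_polyXY N) 'I_p 'I_q)`_i`_k =
  \sum_(L : labelled B p q | is_involution L.2.2 && stable_graph_of_degree (to_graph L))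
    graph_chiM (to_graph L).
Proof.
transitivity (\sum_(G : lgraph 'I_p 'I_q | is_involution G.2 && is_connected G.1 G.2)
   (k == nfix G.2)%:R * (\prod_v vertex_poly N (degree G.1 v))`_i).
  rewrite !coef_sum; apply: eq_bigr => -[e s] _ /=.
  have -> : \prod_v vertex_polyXY N (degree e v) =
      map_poly polyC (\prod_v vertex_poly N (degree e v)) by rewrite rmorph_prod.
  by rewrite coefCM coef_map /= coefMC coefXn.
under eq_bigr do rewrite coef_prod_vertex_poly mulr_sumr.
rewrite pair_big_dep /= (reindex (fun L : labelled B p q => (L.2, L.1))) /=; last first.
  by exists (fun u => (u.2, u.1)) => -[].
rewrite big_mkcond [RHS]big_mkcond; apply: eq_bigr => -[ga [e s]] _ /=.
case sI: (is_involution s) => //=.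
set G := to_graph _.
have flipE : flip_ffun G = s by apply/ffunP=> h; rewrite ffunE /= /safe_flip sI.
have endE : end_ffun G = e by apply/ffunP=> h; rewrite ffunE.
rewrite /stable_graph_of_degree connected_graphE endE flipE.
have -> : n_external G = nfix s.
  by apply: eq_card => h; rewrite !inE /= /safe_flip sI.
case: (is_connected e s) => //=.
rewrite /stable_graph /graph_degree [k == _]eq_sym.
case: (nfix s == k); rewrite ?mul0r ?mul1r /= ?andbF ?if_same //.
Qed.
End ConnectedSeries.

Section ConnectedSeriesCoefficients.
Variable N : nat.
Local Notation B := (genus_bound N).

Lemma stable_graph_of_degree_isom i k (G G' : graph) : isomorphic G G' ->
  stable_graph_of_degree i k G = stable_graph_of_degree i k G'.
Proof.
suff imp (G1 G2 : graph) : isomorphic G1 G2 ->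
    stable_graph_of_degree i k G1 -> stable_graph_of_degree i k G2.
  by move=> iso; apply/idP/idP; apply: imp; rewrite // isomorphic_sym.
case/existsP=> phi iso /and4P[conn stab /eqP next /eqP deg]; apply/and4P; split.
- exact: isom_connected iso conn.
- have stabE (K : graph) : stable_graph K =
      \big[andb/true]_(v < nvert K) stable_type (vgenus v) (valence v).
    by rewrite big_andE.
  by rewrite stabE (isom_big_vertices iso) -stabE.
- by rewrite (isom_n_external iso) next.
by rewrite /graph_degree (isom_big_vertices iso _ (fun g n => 2 * g + n - 2)%N) -/(graph_degree _) deg.
Qed.

Lemma graph_chiM_isom (G G' : graph) : isomorphic G G' -> graph_chiM G = graph_chiM G'.
Proof. by case/existsP=> phi iso; rewrite /graph_chiM (isom_big_vertices iso). Qed.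

Lemma stable_graph_bounds i k (G : graph) : (i <= N)%N -> stable_graph_of_degree i k G ->
  [/\ (nvert G < N.+1)%N, (nhalf G < (3 * N).+1)%N
    & forall v : 'I_(nvert G), (vgenus v < B)%N].
Proof.
move=> iN /and4P[_ /forallP stab _ /eqP deg].
have sum_val : (\sum_(v < nvert G) valence v = nhalf G)%N.
  rewrite -[RHS]card_ord -(sum_degree (end_ffun G)); apply: eq_bigr => v _.
  by apply: eq_card => h; rewrite !inE ffunE.
split.
- rewrite ltnS (leq_trans _ iN) // -deg -[X in (X <= _)%N](card_ord (nvert G)) -sum1_card.
  by apply: leq_sum => v _; have := stab v; rewrite /stable_type; lia.
- rewrite ltnS -sum_val (@leq_trans (3 * i)) //; last by lia.
  rewrite -deg big_distrr /=.
  by apply: leq_sum => v _; have := stab v; rewrite /stable_type; lia.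
move=> v; rewrite /genus_bound.
have : (2 * vgenus v + valence v - 2 <= i)%N.
  by rewrite -deg /graph_degree (bigD1 v) //= leq_addr.
lia.
Qed.

Lemma stable_graph_of_degreeE i k g (G : graph) : (2 * g + k = i + 2)%N ->
  stable_graph_of_degree i k G = stable_graph_of_type G g k.
Proof.
move=> gk; rewrite /stable_graph_of_degree /stable_graph_of_type.
case conn : (connected_graph G) => //=; case stab : (stable_graph G) => //=.
have := graph_genusE conn stab; case: (eqVneq (n_external G) k) => [-> | ] /=.
  by move=> E; rewrite andbT; apply/eqP/eqP; lia.
by rewrite andbF.
Qed.

(** At most one genus g is compatible with the order i and the number k of
external edges; then the classes summed are those in the definition of chiMbar. *)
Lemma coef_connected_series i k : (i <= N)%N ->
  (connected_series polyC 'X (vertex_polyXY N) N)`_i`_k =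
  \sum_(g < B | stable_type g k && (2 * g + k == i + 2)%N) chiMbar g k / k`!%:R.
Proof.
move=> iN; case: (posnP i) => [i0 | i_gt0].
  rewrite i0 connected_series_coef0 ?coef0; last exact: coef_vertex_polyXY_low.
  by rewrite big1 // => g; rewrite /stable_type => /andP[]; lia.
transitivity (\sum_(c \in [set c : graph_class | stable_graph_of_degree i k (repr c)]%classic)
    (card_aut (repr c))%:R^-1 * graph_chiM (repr c)).
  rewrite (sum_graph_classes (stable_graph_of_degree_isom i k) graph_chiM_isom
    (fun G => stable_graph_bounds iN)).
  rewrite !coef_sum; apply: eq_bigr => p _; rewrite !coef_sum; apply: eq_bigr => q _.
  by rewrite coefZ coefCM coef_connected_sum.
case: (pickP (fun g : 'I_B => stable_type g k && (2 * g + k == i + 2)%N)) => [g | none].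
  case/andP=> st /eqP gk; rewrite (big_pred1 g) => [|g'] /=; last first.
    rewrite /stable_type -val_eqE /=; move: st; rewrite /stable_type; lia.
  rewrite /chiMbar mulrC mulKf ?pnatr_eq0 -?lt0n ?fact_gt0 //.
  apply: eq_fsbigl; apply/seteqP; split=> c /=; by rewrite (stable_graph_of_degreeE _ gk).
rewrite [RHS]big_pred0 // fsbig1 // => c /= Pc; exfalso.
have /and4P[conn stab /eqP next /eqP deg] := Pc.
have := graph_genusE conn stab; rewrite next deg => gk.
have gB : (graph_genus (repr c) < B)%N.
  by move: (graph_genus _) gk => g gk; rewrite /genus_bound; lia.
have := none (Ordinal gB); rewrite /= gk eqxx andbT /stable_type gk; lia.
Qed.
End ConnectedSeriesCoefficients.

(** * The two series of the theorem as polynomials *)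

Definition split_nat (j : nat) : seq (nat * nat) :=
  [seq (i, (j - i)%N) | i <- iota 0 j.+1].

Lemma split_nat_uniq j : uniq (split_nat j).
Proof. by rewrite map_inj_uniq ?iota_uniq // => i i' []. Qed.

Lemma mem_split_nat j d : (d \in split_nat j) = (d.1 + d.2 == j)%N.
Proof.
apply/mapP/eqP=> [[i] | <-]; first by rewrite mem_iota => ij ->; rewrite /=; lia.
by exists d.1; [rewrite mem_iota; lia | rewrite addKn; case: d].
Qed.

Lemma coef_split (A : nzRingType) (p q : {poly A}) j :
  (p * q)`_j = \sum_(d <- split_nat j) p`_d.1 * q`_d.2.
Proof. by rewrite coefM big_map -(big_mkord xpredT (fun i => p`_i * q`_(j - i))). Qed.

(** For series in y and z the order is n - a, i.e. 2g - 2 + n on the monomial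
y^n z^(2-2g). *)
Definition wtY (n : nat) : int := n%:Z.
Definition coefY (n : nat) : {additive {poly rat} -> rat} := coefp n.

Definition representsY := @represents nat wtY {poly rat} coefY.

Lemma wtYD n m : wtY (n + m) = wtY n + wtY m.
Proof. by rewrite /wtY PoszD. Qed.

Lemma coefY1 n : coefY n 1 = (n == 0)%:R.
Proof. by rewrite /= coef1. Qed.

Lemma coefYZ n a p : coefY n (polyC a * p) = a * coefY n p.
Proof. by rewrite /= coefCM. Qed.

Lemma coefYM n p q : coefY n (p * q) = \sum_(d <- split_nat n) coefY d.1 p * coefY d.2 q.
Proof. exact: coef_split. Qed.

Definition representsY_exp :=
  represents_exp wtYD split_nat_uniq mem_split_nat coefY1 coefYZ coefYM.

Lemma coef_vertex_series N i n : (i <= N)%N ->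
  (vertex_series (vertex_poly N) N)`_i`_n = n`!%:R^-1 * (vertex_poly N n)`_i.
Proof.
move=> iN; rewrite /vertex_series coef_swapXY coef_poly.
case: ltnP => [_ | nN]; first by rewrite coefZ.
by rewrite coef0 coef_vertex_poly_low ?mulr0 //; lia.
Qed.

Lemma representsY_vertex_series N :
  representsY N (fsum stable_types (fun '(g, n) => (chiM g n / n`!%:R) \*o monYZ n (2 - 2 * g%:Z)))
    (vertex_series (vertex_poly N) N).
Proof.
apply: representsP => [n i iN | n a neg]; rewrite /fsum; last first.
  rewrite fsbig1 // => -[g n'] /= st; rewrite /monYZ /monomial /=.
  rewrite (_ : (_ == _) = false) ?mulr0 //.
  apply/negP=> /eqP [nn' aE]; move: neg st; rewrite nn' aE /wtY /stable_types /= /stable_type.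
  lia.
rewrite /= coef_vertex_series // coef_sum mulr_sumr.
rewrite (finite_sum_seq (r := map (fun g : 'I_(genus_bound N) => (val g, n))
   [seq g <- enum 'I_(genus_bound N) | stable_type (val g) n])).
- rewrite big_map big_filter big_enum_cond /=; apply: eq_bigr => g st.
  rewrite coefZ coefXn mulrA [_^-1 * _]mulrC; congr (_ * _).
  rewrite /monYZ /monomial xpair_eqE eqxx /=; congr (nat_of_bool _)%:R.
  by move: st; rewrite /stable_type /wtY => st; apply/eqP/eqP; lia.
- rewrite map_inj_uniq; first exact/filter_uniq/enum_uniq.
  by move=> g g' [] /val_inj.
- by move=> p /mapP[g]; rewrite mem_filter => /andP[st _] ->.
move=> [g n'] st notin; rewrite /monYZ /monomial /=.
rewrite (_ : (_ == _) = false) ?mulr0 //.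
apply/negP=> /eqP [nn' aE]; case/negP: notin; apply/mapP.
have gB : (g < genus_bound N)%N.
  by rewrite /genus_bound; move: aE; rewrite /wtY; lia.
exists (Ordinal gB); last by rewrite nn'.
by rewrite mem_filter mem_enum andbT nn'.
Qed.

Definition split_pair (j : nat * nat) : seq ((nat * nat) * (nat * nat)) :=
  [seq ((d.1, e.1), (d.2, e.2)) | d <- split_nat j.1, e <- split_nat j.2].

Lemma split_pair_uniq j : uniq (split_pair j).
Proof.
apply: allpairs_uniq; rewrite ?split_nat_uniq //.
by move=> [[d1 d2] [e1 e2]] [[d1' d2'] [e1' e2']] _ _ [-> -> -> ->].
Qed.

Lemma mem_split_pair j d : (d \in split_pair j) = (d.1 + d.2 == j).
Proof.
case: j d => [j1 j2] [[a1 a2] [b1 b2]]; apply/allpairsP/eqP=> [[[d e] /= []] | [<- <-]].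
  by rewrite !mem_split_nat => /eqP <- /eqP <- [-> -> -> ->].
by exists ((a1, b1), (a2, b2)); split; rewrite //= mem_split_nat.
Qed.

(** For series in x, y and z the order is 2n - a, where n is the exponent of y: it
is 1 on x y z, 2 on (y z)^2 and 2g - 2 + n on x^n z^(2-2g-n). *)
Definition wtXY (j : nat * nat) : int := 2 * j.2%:Z.

Definition coefXY (j : nat * nat) (p : {poly {poly rat}}) : rat := p`_j.2`_j.1.

Lemma coefXY_is_zmod j : zmod_morphism (coefXY j).
Proof. by move=> p q; rewrite /coefXY !coefB. Qed.

HB.instance Definition _ j :=
  GRing.isZmodMorphism.Build {poly {poly rat}} rat (coefXY j) (coefXY_is_zmod j).

Definition representsXY :=
  @represents (nat * nat)%type wtXY {poly {poly rat}} (fun j => coefXY j).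

Lemma wtXYD j l : wtXY (j + l) = wtXY j + wtXY l.
Proof. by rewrite /wtXY /= PoszD mulrDr. Qed.

Lemma coefXY1 j : coefXY j 1 = (j == 0)%:R.
Proof.
case: j => k n; rewrite (_ : ((k, n) == 0) = (k == 0%N) && (n == 0%N)) // /coefXY /= coef1.
by case: n => [|n]; rewrite ?andbT ?andbF /= ?coef1 ?coef0.
Qed.

Lemma coefXYZ j a p : coefXY j (rat2 a * p) = a * coefXY j p.
Proof. by rewrite /coefXY /= coefCM coefCM. Qed.

Lemma coefXYM j p q :
  coefXY j (p * q) = \sum_(d <- split_pair j) coefXY d.1 p * coefXY d.2 q.
Proof.
rewrite /coefXY coef_split coef_sum /split_pair big_allpairs_dep exchange_big /=.
by apply: eq_bigr => e _; rewrite coef_split.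
Qed.

Definition representsXY_pow := representsX wtXYD split_pair_uniq mem_split_pair coefXY1 coefXYM.
Definition representsXY_exp :=
  represents_exp wtXYD split_pair_uniq mem_split_pair coefXY1 coefXYZ coefXYM.

Lemma representsXY_opp N f P : representsXY N f P -> representsXY N (\- f) (- P).
Proof.
move=> fP; apply: representsP => [j i iN | j a neg] /=.
  by rewrite coefN raddfN (represents_coef _ fP).
by rewrite (represents_neg fP neg) oppr0.
Qed.

Lemma representsXY_scale N f P a : representsXY N f P ->
  representsXY N (a \*o f) ((rat2 a)%:P * P).
Proof.
move=> fP; apply: representsP => [j i iN | j b neg] /=.
  by rewrite coefCM coefXYZ (represents_coef _ fP).
by rewrite (represents_neg fP neg) mulr0.
Qed.

Lemma representsXY_monomial N k n (a : int) i : 2 * n%:Z - a = i%:Z ->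
  representsXY N (monXYZ k n a) ((('X^k)%:P * 'X^n)%:P * 'X^i).
Proof.
move=> wt_i; rewrite /monXYZ /monomial; apply: representsP => [[k' n'] i' _ | [k' n'] b neg].
  rewrite coefCM coefXn /coefXY /=.
  have -> : (((k', n'), wtXY (k', n') - i'%:Z) == ((k, n), a)) =
            [&& k' == k, n' == n & i' == i].
    rewrite !xpair_eqE -andbA; case: (k' == k) => //=.
    by case: eqP => //= ->; apply/eqP/eqP; rewrite /wtXY /=; lia.
  case: (i' == i); last by rewrite !andbF mulr0 /coefXY !coef0.
  rewrite mulr1 /coefXY /= coefCM coefXn; case: (n' == n); last by rewrite !andbF /= mulr0 coef0.
  by rewrite mulr1 coefXn !andbT.
rewrite (_ : (_ == _) = false) //; apply/negP=> /eqP[_ nn' bb].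
by move: neg; rewrite /wtXY /= nn' bb; lia.
Qed.

(** * The inversion formula *)

Lemma solves_exp_ode_map (R S : comNzRingType) (f : {rmorphism R -> S}) N P Y :
  solves_exp_ode N P Y -> solves_exp_ode N (map_poly f P) (map_poly f Y).
Proof.
case=> Y0 Yode; split; first by rewrite coef_map /= Y0 rmorph1.
by move=> i iN; rewrite !deriv_map -rmorphM /= !coef_map /= Yode.
Qed.

Lemma representsXY_connected_series N :
  representsXY N (fsum stable_types (fun '(g, n) =>
      (chiMbar g n / n`!%:R) \*o monXYZ n 0 (2 - 2 * g%:Z - n%:Z)))
    (map_poly polyC (connected_series polyC 'X (vertex_polyXY N) N)).
Proof.
apply: representsP => [[k n] i iN | [k n] a neg]; rewrite /fsum; last first.
  rewrite fsbig1 // => -[g n'] /= st; rewrite /monXYZ /monomial /=.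
  rewrite (_ : (_ == _) = false) ?mulr0 //.
  apply/negP=> /eqP [kn' n0 aE]; move: neg st; rewrite n0 aE /wtXY /= /stable_types /= /stable_type.
  lia.
rewrite /= /coefXY /= coef_map /= coefC; case: (posnP n) => [-> | n_gt0]; last first.
  rewrite /= coef0 fsbig1 // => -[g n'] _; rewrite /monXYZ /monomial /=.
  rewrite (_ : (_ == _) = false) ?mulr0 //.
  by apply/negP=> /eqP[_ n0 _]; rewrite n0 in n_gt0.
rewrite /= coef_connected_series //.
rewrite (finite_sum_seq (r := map (fun g : 'I_(genus_bound N) => (val g, k))
   [seq g : 'I_(genus_bound N) <- enum 'I_(genus_bound N) | stable_type g k && (2 * g + k == i + 2)%N])).
- rewrite big_map big_filter big_enum_cond /=; apply: eq_bigr => g /andP[st /eqP gk].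
  rewrite /monXYZ /monomial (_ : (_ == _) = true) ?mulr1 //.
  by apply/eqP; congr (_, _, _); rewrite /wtXY /=; lia.
- rewrite map_inj_uniq; first exact/filter_uniq/enum_uniq.
  by move=> g g' [] /val_inj.
- by move=> p /mapP[g]; rewrite mem_filter => /andP[/andP[st _] _] ->.
move=> [g n'] st notin; rewrite /monXYZ /monomial /=.
rewrite (_ : (_ == _) = false) ?mulr0 //.
apply/negP=> /eqP [kn' aE]; case/negP: notin; apply/mapP.
have gk : (2 * g + k = i + 2)%N by move: aE; rewrite /wtXY /= kn'; lia.
have gB : (g < genus_bound N)%N by rewrite /genus_bound; lia.
exists (Ordinal gB); last by rewrite kn'.
by rewrite mem_filter mem_enum andbT /= gk eqxx andbT kn'.
Qed.

Definition shifted_exponent : fseries xyz_exponent :=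
  (2^-1 \*o fpow (monXYZ 1 0 0 \- monXYZ 0 1 1) 2) \- (2^-1 \*o monXYZ 2 0 0).

(** The square of x - y z loses its term in x^2, whose order is 0; what remains has
positive order and can be exponentiated. *)
Lemma representsXY_shift N : representsXY N shifted_exponent shift_exponent.
Proof.
have rep_x : representsXY N (monXYZ 1 0 0) ((('X^1)%:P * 'X^0)%:P * 'X^0).
  by apply: representsXY_monomial.
have rep_yz : representsXY N (monXYZ 0 1 1) ((('X^0)%:P * 'X^1)%:P * 'X^1).
  by apply: representsXY_monomial.
have rep_x2 : representsXY N (monXYZ 2 0 0) ((('X^2)%:P * 'X^0)%:P * 'X^0).
  by apply: representsXY_monomial.
have rep_diff := representsD rep_x (representsXY_opp rep_yz).
have rep_half := representsXY_scale 2^-1 (representsXY_pow 2 rep_diff).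
have rep := representsD rep_half (representsXY_opp (representsXY_scale 2^-1 rep_x2)).
pose h : {poly {poly {poly rat}}} := (rat2 2^-1)%:P.
pose X : {poly {poly {poly rat}}} := 'X%:P%:P.
pose Y : {poly {poly {poly rat}}} := 'X%:P.
have halfD : h + h = 1.
  by rewrite /h -polyCD -rmorphD (_ : 2^-1 + 2^-1 = 1 :> rat) ?rmorph1 // -mulr2n -[LHS]mulr_natr mulVf.
have E1 : (('X^1)%:P * 'X^0)%:P * 'X^0 = X by rewrite !expr0 !mulr1.
have E2 : (('X^0)%:P * 'X^1)%:P * 'X^1 = Y * 'X by rewrite expr0 !expr1 mul1r.
have E3 : (('X^2)%:P * 'X^0)%:P * 'X^0 = X ^+ 2 by rewrite !expr0 !mulr1 !rmorphXn.
have E4 : shift_exponent = - (X * Y) * 'X + h * Y ^+ 2 * 'X ^+ 2.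
  by rewrite /shift_exponent -2!mul_polyC polyCN 2!polyCM rmorphXn.
suff -> : shift_exponent = h * (X - Y * 'X) ^+ 2 - h * X ^+ 2.
  by move: rep; rewrite E1 E2 E3.
rewrite E4; move: ('X) => T.
transitivity (- (h + h) * (X * Y) * T + h * Y ^+ 2 * T ^+ 2); last by ring.
by rewrite halfD mulN1r.
Qed.

Lemma gauss_sum_functional (p : {poly rat}) :
  \sum_(k \in [set: nat]%classic) gauss_moment k * p`_k = gauss_functional p.
Proof.
rewrite (finite_sum_seq (r := index_iota 0 (size p))) ?iota_uniq ?big_mkord //.
by move=> k _; rewrite mem_index_iota /= -leqNgt => sk; rewrite nth_default ?mulr0.
Qed.

Theorem corollary7p1 :
  fexp (fsum stable_types (fun '(g, n) =>
    (chiM g n / n`!%:R) \*o monYZ n (2 - 2 * g%:Z)))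
  = gauss_integral
      ((2^-1 \*o fpow (monXYZ 1 0 0 \- monXYZ 0 1 1) 2)
       \+ fsum stable_types (fun '(g, n) =>
            (chiMbar g n / n`!%:R) \*o monXYZ n 0 (2 - 2 * g%:Z - n%:Z))).
Proof.
set V := fsum _ _; set Vbar := fsum _ (fun '(g, n) => _ \*o monXYZ _ _ _).
apply/funext=> -[n a]; rewrite /gauss_integral /=.
set f := _ \- _.
have fE : f = shifted_exponent \+ Vbar.
  by apply/funext=> m; rewrite /f /shifted_exponent /=; ring.
have V0 N : (vertex_series (vertex_poly N) N)`_0 = 0.
  by apply/polyP=> j; rewrite coef_vertex_series // coef_vertex_poly_low ?mulr0 ?coef0.
have repV N : representsY N (fexp V) (pexp polyC N (vertex_series (vertex_poly N) N)).
  exact: (representsY_exp (V0 N) (representsY_vertex_series N)).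
pose C N := map_poly polyC (connected_series polyC 'X (vertex_polyXY N) N).
pose A N := map_poly polyC (graph_series polyC 'X (vertex_polyXY N) N).
have Q0 N : (shift_exponent + C N)`_0 = 0.
  rewrite coefD coef_map connected_series_coef0 ?rmorph0 ?addr0; last exact: coef_vertex_polyXY_low.
  by rewrite /shift_exponent coefD !coefZ coefX coefXn !mulr0 addr0.
have repf N : representsXY N (fexp f) (pexp rat2 N (shift_exponent + C N)).
  rewrite fE; apply: (representsXY_exp (Q0 N)).
  exact: (representsD (representsXY_shift N) (representsXY_connected_series N)).
have ode N : solves_exp_ode N (shift_exponent + C N) (shift_series N * A N).
  apply: solves_exp_odeM; first exact: shift_series_solves.
  by apply: solves_exp_ode_map; apply: graph_series_solves; apply: coef_vertex_polyXY_low.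
(* The coefficient of y^n in the product selects h_n, which takes up n of the N
   units of order; the remaining N - n = n - a come from the sum over graphs. *)
have coefQ N k : 2 * n%:Z - a = N%:Z -> fexp f (k, n, a) =
    (if (n <= N)%N then hermite n * (graph_series polyC 'X (vertex_polyXY N) N)`_(N - n) else 0)`_k.
  move=> aN; have := repf N (k, n) a; rewrite {1}/wtXY /= aN => -> //.
  rewrite /coefXY /= (pexp_unique rat2 (Q0 N) (ode N)) //; congr (_`_k).
  rewrite coefM coef_sum; case: leqP => [nN | Nn].
    rewrite (bigD1 (Ordinal (nN : (n < N.+1)%N))) //= big1 => [|j jn].
      by rewrite addr0 coef_poly ltnS nN coef_map /= coefMC coefZ coefXn eqxx mulr1.
    rewrite coef_poly ltn_ord coef_map /= coefMC coefZ coefXn.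
    by rewrite eq_sym (negbTE (jn : (nat_of_ord j != n))) mulr0 mul0r.
  rewrite big1 // => j _; rewrite coef_poly ltn_ord coef_map /= coefMC coefZ coefXn.
  have -> : (n == j) = false by have := ltn_ord j; lia.
  by rewrite mulr0 mul0r.
(* Negative order of (n, a): both sides vanish, because n - a <= 2n - a. *)
case E : (2 * n%:Z - a) => [N | N]; last first.
  rewrite (represents_neg (repV 0)) ?fsbig1 //; last by rewrite /wtY; lia.
  move=> k _; rewrite (represents_neg (repf 0)) ?mulr0 //; by rewrite /wtXY /=; lia.
under eq_fsbigr => k _ do rewrite (coefQ N k E).
rewrite gauss_sum_functional; case: leqP => [nN | Nn]; last first.
  by rewrite linear0 (represents_neg (repV 0)) // /wtY; lia.
rewrite coef_graph_series mulr_sumr linear_sum /=.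
under eq_bigr do rewrite -scalerAr linearZ /= gauss_hermite_involution.
have n3N : (n < (3 * N).+1)%N by lia.
rewrite (bigD1 (Ordinal n3N)) //= eqxx mulr1 big1 ?addr0 => [|q qn]; last first.
  by rewrite eq_sym (negbTE (qn : nat_of_ord q != n)) mulr0.
have := repV N n a; have -> : wtY n - a = (N - n)%N%:Z by rewrite /wtY; lia.
by apply; rewrite leq_subr.
Qed.
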